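(* Let $\mathcal{A}\subset M_n(\mathbb{F}_q)$ be an $\mathbb{F}_q$-subalgebra of dimension $m$ with basis $v_1,\dots,v_m$, let $\mathbf{t}=(t_1,\dots,t_m)$ be indeterminates, $K=\mathbb{F}_q(\mathbf{t})$, and $A(\mathbf{t})=\sum_{i=1}^mt_iv_i\in\mathrm{GL}_n(K)$. Let $N\in\mathrm{GL}_n(K)$ be such that $N^{-1}A N^{(q)}=\Delta$, where $\Delta$ is the matrix with $1$'s on the subdiagonal, last column $(a_0,\dots,a_{n-1})^T$ ($a_i\in K$) and all other entries $0$, and let $f(Y;\mathbf{t})=Y^{q^n}-a_0Y-a_1Y^q-\cdots-a_{n-1}Y^{q^{n-1}}\in\mathbb{F}_q(\mathbf{t})[Y]$. Then $f(Y;\mathbf{t})$ is $\mathcal{A}^\times$-generic over every infinite field $k$ containing $\mathbb{F}_q$.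
   Context: $N^{(q)}$ denotes entrywise $q$-th power. Definition: for a field $k$ and a finite group $G$, a monic separable polynomial $f(Y;\mathbf{t})\in k(\mathbf{t})[Y]$, $\mathbf{t}=(t_1,\dots,t_m)$, is $G$-generic over $k$ if (1) the Galois group of $f$ over $k(\mathbf{t})$ is isomorphic to $G$, and (2) every Galois $G$-extension $M/L$, where $L$ is a field containing $k$, is the splitting field over $L$ of a specialization $f(Y;\boldsymbol\xi)$ for some $\boldsymbol\xi\in L^m$. *)

(* Defs.v *)
From HB Require Import structures.
From mathcomp Require Import all_boot all_order all_algebra all_fingroup all_field.
From mathcomp Require Import fraction.
From mathcomp.multinomials Require Import mpoly.

Set Implicit Arguments.
Unset Strict Implicit.
Unset Printing Implicit Defensive.

Local Open Scope ring_scope.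

Definition ratfun (F : fieldType) (m : nat) := {fraction {mpoly F[m]}}.

Definition rf_var (F : fieldType) (m : nat) (i : 'I_m) : ratfun F m :=
  tofrac ('X_i : {mpoly F[m]}).
Definition rf_const (F : fieldType) (m : nat) (c : F) : ratfun F m :=
  tofrac (c%:MP : {mpoly F[m]}).

(* Specialization of a rational function c in F(t) at t := xi (xi in L^m),
   along the embedding phi : F -> L: y is the value c(xi), i.e. c = u/v with
   v(xi) <> 0 and y = u(xi)/v(xi) (well defined, independent of u,v). *)
Definition frac_spec (F : fieldType) (m : nat) (L : fieldType) (phi : F -> L)
    (xi : 'I_m -> L) (c : ratfun F m) (y : L) : Prop :=
  exists u v : {mpoly F[m]},
    [/\ mmap phi xi v != 0, c = tofrac u / tofrac v
      & y = mmap phi xi u / mmap phi xi v].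

Definition poly_spec (F : fieldType) (m : nat) (L : fieldType) (phi : F -> L)
    (xi : 'I_m -> L) (f : {poly ratfun F m}) (g : {poly L}) : Prop :=
  forall i : nat, frac_spec phi xi f`_i g`_i.

Definition generic_mx (F : fieldType) (m n : nat) (v : 'I_m -> 'M[F]_n) :
    'M[ratfun F m]_n :=
  \matrix_(r, s) \sum_(i < m) rf_var F i * rf_const m (v i r s).

Definition Delta_mx (K : nzRingType) (n : nat) (a : 'I_n.+1 -> K) : 'M[K]_n.+1 :=
  \matrix_(i, j) if j == ord_max then a i
                 else if (i : nat) == j.+1 then 1 else 0.

Definition qlin_poly (K : nzRingType) (q n : nat) (a : 'I_n.+1 -> K) : {poly K} :=
  'X^(q ^ n.+1) - \sum_(i < n.+1) a i *: 'X^(q ^ i).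

Definition alg_units (F : finFieldType) (n : nat) (S : {vspace 'M[F]_n.+1}) :
    {set {'GL_n.+1[F]}} :=
  [set u : {'GL_n.+1[F]} | GLval u \in S].

Definition infinite_field (k : fieldType) : Prop :=
  forall s : seq k, exists x, x \notin s.

(* Main.v *)
(* For an invertible X in the algebra tensored with a field, the Lang map
   X |-> X^-1 * X^(q) has fibres that are orbits of the finite group of units
   of the algebra acting by left translation. Expanding it along the line
   1 + eps z shows that it is dominant in every characteristic (its linear part
   at 1 is -z), so the generic element A(t) can be specialised to
   X^-1 * X^(q) with X generic: this is an endomorphism theta of k(t), with
   t |-> coordinates of the Lang map. The roots of f are the F-linear
   combinations of the first column of X N, so theta extends to the splitting
   field E of f over k(t), whose image contains X. The Galois group of E then
   acts on X by left translations by units, and every translation occurs, since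
   the translations of X give as many distinct conjugates of a primitive element
   of E. Conversely, a Galois extension M/L with the given group has, by
   averaging over the group, a Zariski dense set of X in the algebra over M on
   which the group acts by left translations; X^-1 * X^(q) is then Galois
   invariant, and its coordinates are the required specialisation. *)
Require Import Defs.
From HB Require Import structures.
From mathcomp Require Import all_boot all_order all_algebra all_fingroup all_field.
From mathcomp Require Import fraction.
From mathcomp Require generic_quotient.
From mathcomp.multinomials Require Import mpoly.

Set Implicit Arguments.
Unset Strict Implicit.
Unset Printing Implicit Defensive.

Import GRing.Theory.
Local Open Scope ring_scope.

(** * Matrices over the algebra in coordinates *)

Section Frobenius.

Variables (F : finFieldType) (R : comNzRingType) (phi : {rmorphism F -> R}).

(** The argument [phi] forces [R] to have the characteristic of [F], so that the power map is
    additive. *)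
Definition frob of {rmorphism F -> R} := fun x : R => x ^+ #|F|.

Fact frob_is_zmod_morphism : zmod_morphism (frob phi).
Proof.
have [p pr_p pF] := finPcharP F; have pR := rmorph_pchar phi pF.
have /andP[_ /p_natP[e qE]] : (0 < #|F|)%N && p.-nat #|F|.
  by rewrite (card_pprimeChar pF) pnatX pnat_id ?expn_gt0 ?prime_gt0.
have qR : [pchar R].-nat #|F|.
  by rewrite qE pnatX (pnatE _ pr_p) pR.
have frobD (x y : R) : (x + y) ^+ #|F| = x ^+ #|F| + y ^+ #|F|.
  exact: exprDn_pchar.
move=> x y; rewrite /frob; apply/eqP.
by rewrite eq_sym subr_eq -frobD subrK.
Qed.

Fact frob_is_monoid_morphism : monoid_morphism (frob phi).
Proof. by split=> [|x y]; rewrite /frob ?expr1n ?exprMn. Qed.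

HB.instance Definition _ :=
  GRing.isZmodMorphism.Build R R (frob phi) frob_is_zmod_morphism.
HB.instance Definition _ :=
  GRing.isMonoidMorphism.Build R R (frob phi) frob_is_monoid_morphism.

Lemma frob_id c : frob phi (phi c) = phi c.
Proof. by rewrite /frob -rmorphXn expf_card. Qed.

Lemma map_frob_id p q (A : 'M[F]_(p, q)) :
  map_mx (frob phi) (map_mx phi A) = map_mx phi A.
Proof. by apply/matrixP=> i j; rewrite !mxE frob_id. Qed.

End Frobenius.

Lemma map_frob (F : finFieldType) (R R' : comNzRingType)
    (phi : {rmorphism F -> R}) (phi' : {rmorphism F -> R'})
    (f : {rmorphism R -> R'}) p q (A : 'M[R]_(p, q)) :
  map_mx f (map_mx (frob phi) A) = map_mx (frob phi') (map_mx f A).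
Proof. by apply/matrixP=> i j; rewrite !mxE /frob rmorphXn. Qed.

(** [X^q - X] is the product of the [X - c] over [c] in [F], so a fixed point is a root of one of
    the factors. *)
Lemma frob_fixed (F : finFieldType) (L : fieldType) (phi : {rmorphism F -> L})
    (x : L) : frob phi x = x -> exists c, x = phi c.
Proof.
move=> fx; have /(congr1 (fun p => (map_poly phi p).[x])) := finField_genPoly F.
rewrite rmorphB rmorphXn /= map_polyX !hornerE -/(frob phi x) fx subrr.
rewrite rmorph_prod horner_prod => /esym/eqP/prodf_eq0[c _].
by rewrite rmorphB /= map_polyX map_polyC /= !hornerE subr_eq0 => /eqP; exists c.
Qed.

Lemma frob_fixed_mx (F : finFieldType) (L : fieldType)
    (phi : {rmorphism F -> L}) p q (A : 'M[L]_(p, q)) :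
  map_mx (frob phi) A = A -> exists B, A = map_mx phi B.
Proof.
move=> fA.
have /fin_all_exists[c cE] (ij : 'I_p * 'I_q) : exists c, A ij.1 ij.2 = phi c.
  by apply: frob_fixed; rewrite -[in RHS]fA mxE.
by exists (\matrix_(i, j) c (i, j)); apply/matrixP=> i j; rewrite !mxE -cE.
Qed.

(** * Coordinates with respect to a basis of the algebra *)

Section Comb.

Variables (F : finFieldType) (n m : nat) (v : 'I_m -> 'M[F]_n.+1).

Definition basis_mx : 'M[F]_(m, n.+1 * n.+1) := \matrix_i mxvec (v i).

Section Def.
Variables (R : comNzRingType) (phi : {rmorphism F -> R}).

Definition comb (x : 'rV[R]_m) : 'M[R]_n.+1 :=
  vec_mx (x *m map_mx phi basis_mx).
(** The pseudo-inverse is taken over [F] and then mapped, so that coordinates commute with change of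
    ring; they are meaningful on the span of the basis only. *)
Definition coords (Z : 'M[R]_n.+1) : 'rV[R]_m :=
  mxvec Z *m map_mx phi (pinvmx basis_mx).
(** Left multiplication by [comb x], as a matrix acting on coordinate rows from the right. Its
    determinant turns invertibility in the algebra into a polynomial condition. *)
Definition lmul_mx (x : 'rV[R]_m) : 'M[R]_m :=
  \matrix_j coords (comb x *m comb (delta_mx 0 j)).

Lemma combD x y : comb (x + y) = comb x + comb y.
Proof. by rewrite /comb mulmxDl linearD. Qed.
Lemma combZ c x : comb (c *: x) = c *: comb x.
Proof. by rewrite /comb -scalemxAl linearZ. Qed.
Lemma comb0 : comb 0 = 0.
Proof. by rewrite /comb mul0mx linear0. Qed.
Lemma comb_sum (I : Type) (r : seq I) (P : pred I) f :
  comb (\sum_(i <- r | P i) f i) = \sum_(i <- r | P i) comb (f i).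
Proof. exact: (big_morph _ combD comb0). Qed.
Lemma combE x : comb x = \sum_i x 0 i *: map_mx phi (v i).
Proof.
rewrite /comb mulmx_sum_row linear_sum; apply: eq_bigr => i _.
by rewrite linearZ /= -map_row rowK map_mxvec mxvecK.
Qed.
End Def.

Lemma map_comb (R R' : comNzRingType) (phi : {rmorphism F -> R})
    (phi' : {rmorphism F -> R'}) (f : {rmorphism R -> R'}) x :
  (forall c, f (phi c) = phi' c) ->
  map_mx f (comb phi x) = comb phi' (map_mx f x).
Proof.
move=> ff; rewrite /comb map_vec_mx map_mxM -map_mx_comp.
by congr (vec_mx (_ *m _)); apply/matrixP=> i j; rewrite !mxE /= ff.
Qed.

Lemma map_coords (R R' : comNzRingType) (phi : {rmorphism F -> R})
    (phi' : {rmorphism F -> R'}) (f : {rmorphism R -> R'}) Z :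
  (forall c, f (phi c) = phi' c) ->
  map_mx f (coords phi Z) = coords phi' (map_mx f Z).
Proof.
move=> ff; rewrite /coords map_mxM map_mxvec -map_mx_comp.
by congr (_ *m _); apply/matrixP=> i j; rewrite !mxE /= ff.
Qed.

Lemma map_lmul_mx (R R' : comNzRingType) (phi : {rmorphism F -> R})
    (phi' : {rmorphism F -> R'}) (f : {rmorphism R -> R'}) x :
  (forall c, f (phi c) = phi' c) ->
  map_mx f (lmul_mx phi x) = lmul_mx phi' (map_mx f x).
Proof.
move=> ff; apply/row_matrixP=> j; rewrite -map_row !rowK.
by rewrite (map_coords _ ff) map_mxM !(map_comb _ ff) map_delta_mx.
Qed.

Hypothesis freeV : row_free basis_mx.

Section Theory.
Variables (R : comNzRingType) (phi : {rmorphism F -> R}).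
Local Notation comb := (comb phi).
Local Notation coords := (coords phi).

Lemma combK : cancel comb coords.
Proof. by move=> x; rewrite /coords vec_mxK -mulmxA -map_mxM mulmxVp // map_mx1 mulmx1. Qed.
Lemma comb_inj : injective comb. Proof. exact: can_inj combK. Qed.

Lemma frob_comb x : map_mx (frob phi) (comb x) = comb (map_mx (frob phi) x).
Proof. by apply: map_comb => c; rewrite /= frob_id. Qed.


Hypothesis closedV : forall i j, exists z : 'rV_m,
  mxvec (v i *m v j) = z *m basis_mx.

(** The structure constants [z i j] lie in [F]; bilinearity carries closure under products to every
    ring over [F]. *)
Lemma comb_mulP x y : exists z, comb x *m comb y = comb z.
Proof.
have /fin_all_exists[z' z'E] (ij : 'I_m * 'I_m) :
    exists z : 'rV_m, mxvec (v ij.1 *m v ij.2) = z *m basis_mx.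
  exact: closedV.
pose z i j := z' (i, j).
have zE i j : comb (map_mx phi (z i j)) = map_mx phi (v i) *m map_mx phi (v j).
  rewrite /comb -map_mxM -map_vec_mx -(z'E (i, j)) mxvecK.
  exact: map_mxM.
exists (\sum_i \sum_j (x 0 i * y 0 j) *: map_mx phi (z i j)).
rewrite comb_sum !combE mulmx_suml; apply: eq_bigr => i _.
rewrite comb_sum mulmx_sumr; apply: eq_bigr => j _.
by rewrite combZ zE -scalemxAl -scalemxAr scalerA.
Qed.

Lemma comb_mul x y : comb (coords (comb x *m comb y)) = comb x *m comb y.
Proof. by have [z ->] := comb_mulP x y; rewrite combK. Qed.

Lemma mulmx_comb x y : comb x *m comb y = comb (y *m lmul_mx phi x).
Proof.
rewrite [y in LHS]row_sum_delta comb_sum mulmx_sumr mulmx_sum_row comb_sum.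
apply: eq_bigr => j _.
by rewrite !combZ rowK comb_mul scalemxAr.
Qed.

Lemma coords_mul x y : coords (comb x *m comb y) = y *m lmul_mx phi x.
Proof. by rewrite mulmx_comb combK. Qed.

Hypothesis oneV : exists e : 'rV_m, mxvec 1%:M = e *m basis_mx.

Lemma comb_coords1 : comb (coords 1%:M) = 1%:M.
Proof.
have [e eE] := oneV.
have <- : comb (map_mx phi e) = 1%:M.
  by rewrite /comb -map_mxM -eE map_mxvec map_mx1 mxvecK.
by rewrite combK.
Qed.

Lemma mul1_lmul x : coords 1%:M *m lmul_mx phi x = x.
Proof. by rewrite -coords_mul comb_coords1 mulmx1 combK. Qed.

Lemma lmul_mx1 : lmul_mx phi (coords 1%:M) = 1%:M.
Proof.
apply/row_matrixP=> j; apply: comb_inj; rewrite rowE -mulmx_comb comb_coords1.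
by rewrite mul1mx rowE mulmx1.
Qed.

Lemma frob_coords1 : map_mx (frob phi) (coords 1%:M) = coords 1%:M.
Proof.
rewrite (map_coords (phi' := phi)) ?map_mx1 // => c.
exact: frob_id.
Qed.

End Theory.

Section FieldTheory.
Variables (L : fieldType) (phi : {rmorphism F -> L}).
Hypothesis closedV : forall i j, exists z : 'rV_m,
  mxvec (v i *m v j) = z *m basis_mx.
Hypothesis oneV : exists e : 'rV_m, mxvec 1%:M = e *m basis_mx.
Local Notation comb := (comb phi).
Local Notation coords := (coords phi).

(** The inverse is found inside the algebra, by solving a linear system for its coordinates. *)
Lemma comb_inv x : \det (lmul_mx phi x) != 0 ->
  exists y, comb x *m comb y = 1%:M /\ comb y *m comb x = 1%:M.
Proof.
move=> dx; exists (coords 1%:M *m invmx (lmul_mx phi x)).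
suff xy : comb x *m comb (coords 1%:M *m invmx (lmul_mx phi x)) = 1%:M.
  by split=> //; apply: mulmx1C.
by rewrite mulmx_comb // mulmxKV ?comb_coords1 // unitmxE unitfE.
Qed.

Lemma comb_unit x : \det (lmul_mx phi x) != 0 -> comb x \in unitmx.
Proof. by case/comb_inv=> y [/mulmx1_unit[]]. Qed.

End FieldTheory.

End Comb.

(** * Evaluation of polynomials over an infinite field *)

Lemma infinite_uniq_seq (k : fieldType) :
  infinite_field k -> forall d, exists s : seq k, uniq s /\ size s = d.
Proof.
move=> infk; elim=> [|d [s [us ss]]]; first by exists [::].
have [x xs] := infk s; exists (x :: s); by rewrite /= xs us ss.
Qed.

Lemma infinite_rmorph (k L : fieldType) (j : {rmorphism k -> L}) :
  infinite_field k -> infinite_field L.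
Proof.
move=> infk s; have [r [ur sr]] := infinite_uniq_seq infk (size s).+1.
have /allPn[y yr ys] : ~~ all (mem s) (map j r).
  apply/negP=> /allP rs.
  have := uniq_leq_size (s1 := map j r) (s2 := s).
  by rewrite (map_inj_uniq (fmorph_inj j)) size_map sr ltnn => /(_ ur rs).
by exists y.
Qed.

(** The root bound, applied to images of elements of [k]: the point comes from the smaller field
    although the coefficients lie in [L]. *)
Lemma poly_nonroot (k L : fieldType) (j : {rmorphism k -> L}) (p : {poly L}) :
  infinite_field k -> p != 0 -> exists x, p.[j x] != 0.
Proof.
move=> infk p0; have [r [ur sr]] := infinite_uniq_seq infk (size p).
have /allPn[y yr ys] : ~~ all (root p) (map j r).
  apply/negP=> /(max_poly_roots p0).
  by rewrite (map_inj_uniq (fmorph_inj j)) size_map sr ltnn ur => /(_ isT).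
by have [x _ yE] := mapP yr; exists x; rewrite -yE.
Qed.

Lemma rmorph_mmap m (R : nzRingType) (S S' : comNzRingType) (f : {rmorphism R -> S})
    (g : {rmorphism R -> S'}) (h : {rmorphism S -> S'}) (x : 'I_m -> S)
    (y : 'I_m -> S') p :
  (forall c, h (f c) = g c) -> (forall i, h (x i) = y i) ->
  h (mmap f x p) = mmap g y p.
Proof.
move=> hf hx; rewrite /mmap rmorph_sum; apply: eq_bigr => a _.
rewrite rmorphM hf /mmap1 rmorph_prod; congr (_ * _).
by apply: eq_bigr => i _; rewrite rmorphXn hx.
Qed.

Lemma muni_coef m (R : nzRingType) (p : {mpoly R[m.+1]}) (a : 'X_{1..m.+1}) :
  ((muni p)`_(a ord_max))@_[multinom a (widen_ord (leqnSn m) i) | i < m] = p@_a.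
Proof.
rewrite [in RHS](mpolyE p) muniE coef_sum !raddf_sum /=.
apply: eq_bigr => b _; rewrite !coefZ !mcoeffZ coefXn mcoeffX.
have -> : (b == a) = (a ord_max == b ord_max) &&
    ([multinom b (widen_ord (leqnSn m) i) | i < m] ==
     [multinom a (widen_ord (leqnSn m) i) | i < m]).
  apply/eqP/andP=> [->|[/eqP om /eqP/mnmP ow]]; first by split.
  apply/mnmP=> i; case: (unliftP ord_max i) => [j ->|->] //.
  have -> : lift ord_max j = widen_ord (leqnSn m) j.
    by apply: val_inj; rewrite /= /bump leqNgt ltn_ord.
  by have := ow j; rewrite !mnmE.
by case: eqP => _; rewrite ?mulr1 ?mulr0 ?mcoeffZ ?mcoeffX ?mcoeff0 ?mulr0.
Qed.

Lemma muni_horner m (R : comNzRingType) (p : {mpoly R[m.+1]}) (u : 'I_m -> R) c :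
  (map_poly (meval u) (muni p)).[c] =
  p.@[fun i => if unlift ord_max i is Some j then u j else c].
Proof.
rewrite muniE [RHS]mevalE raddf_sum /= horner_sum; apply: eq_bigr => a _.
rewrite map_polyZ map_polyXn /= mevalZ mevalX hornerZ hornerXn -mulrA.
rewrite big_ord_recr /= unlift_none.
congr (_ * (_ * _)); apply: eq_bigr => i _; rewrite mnmE.
suff -> : widen_ord (leqnSn m) i = lift ord_max i by rewrite liftK.
by apply: val_inj; rewrite /= /bump leqNgt ltn_ord.
Qed.

(** Induction on the number of variables: some coefficient with respect to the last variable is
    nonzero, and a point where it does not vanish leaves a nonzero polynomial in one variable. *)
Lemma mpoly_nonroot m (k : fieldType) (p : {mpoly k[m]}) :
  infinite_field k -> p != 0 -> exists u, p.@[u] != 0.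
Proof.
move=> infk; elim: m p => [|m IHm] p p0.
  exists (fun=> 0); move: p0; rewrite [p]nvar0_mpolyC mevalC mpolyC_eq0.
  by [].
have [a pa] : exists a, p@_a != 0.
  by exists (mlead p); rewrite mleadc_eq0.
rewrite -muni_coef in pa.
have [|u ua] := IHm (muni p)`_(a ord_max).
  by apply: contraNneq pa => ->; rewrite mcoeff0.
have q0 : map_poly (meval u) (muni p) != 0.
  apply: contraNneq ua => /(congr1 (fun q : {poly k} => q`_(a ord_max))).
  by rewrite coef_map coef0 /= => ->.
have [c cP] := poly_nonroot idfun infk q0.
by exists (fun i => if unlift ord_max i is Some j then u j else c); rewrite -muni_horner.
Qed.

(* [delta ^ d * p (T / delta)], written without division *)
Definition homog_eval m (R : nzRingType) (S : comNzRingType) (f : R -> S)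
    (p : {mpoly R[m]}) (d : nat) (delta : S) (T : 'I_m -> S) : S :=
  \sum_(a <- msupp p) f p@_a * (delta ^+ (d - mdeg a) * mmap1 T a).

Lemma mmap1_scale m (S : comNzRingType) c (T : 'I_m -> S) a :
  mmap1 (fun i => c * T i) a = c ^+ mdeg a * mmap1 T a.
Proof.
rewrite /mmap1 mdegE -prodrXr -big_split /=.
by apply: eq_bigr => i _; rewrite exprMn.
Qed.

Lemma homog_evalE m (R : nzRingType) (L : fieldType) (f : R -> L)
    (p : {mpoly R[m]}) d (delta : L) (T : 'I_m -> L) :
  delta != 0 -> (msize p <= d)%N ->
  homog_eval f p d delta T = delta ^+ d * mmap f (fun i => delta^-1 * T i) p.
Proof.
move=> d0 pd; rewrite /homog_eval /mmap mulr_sumr; apply: eq_big_seq => a ap.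
rewrite mmap1_scale [RHS]mulrCA; congr (_ * _); rewrite mulrA; congr (_ * _).
have ad : (mdeg a <= d)%N by apply: leq_trans (ltnW (msize_mdeg_lt ap)) pd.
by rewrite exprVn -expfB_cond ?(negPf d0).
Qed.

Lemma rmorph_homog_eval m (R : nzRingType) (S S' : comNzRingType) (f : R -> S)
    (g : R -> S') (h : {rmorphism S -> S'}) p d delta (T : 'I_m -> S)
    (T' : 'I_m -> S') :
  (forall c, h (f c) = g c) -> (forall i, h (T i) = T' i) ->
  h (homog_eval f p d delta T) = homog_eval g p d (h delta) T'.
Proof.
move=> hf hT; rewrite /homog_eval rmorph_sum; apply: eq_bigr => a _.
rewrite !rmorphM hf rmorphXn /mmap1 rmorph_prod; congr (_ * (_ * _)).
by apply: eq_bigr => i _; rewrite rmorphXn hT.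
Qed.

(** * The Lang map *)

Section Lang.

Variables (F : finFieldType) (n m : nat) (v : 'I_m -> 'M[F]_n.+1).

Section Def.
Variables (R : comNzRingType) (phi : {rmorphism F -> R}).
(** By Cramer's rule [X^-1 * X^(q)] has numerators [lang_num] and denominator [lmul_det]. Both are
    polynomial in the coordinates, so they make sense over polynomial rings. *)
Definition lmul_det (x : 'rV[R]_m) := \det (lmul_mx v phi x).
Definition lang_num (x : 'rV[R]_m) := map_mx (frob phi) x *m \adj (lmul_mx v phi x).
End Def.

(* coordinates of the Lang map [X |-> X^-1 * X^(q)] *)
Definition lang (L : fieldType) (phi : {rmorphism F -> L}) (x : 'rV[L]_m) :=
  (lmul_det phi x)^-1 *: lang_num phi x.

Section Morphism.
Variables (R R' : comNzRingType) (phi : {rmorphism F -> R}).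
Variables (phi' : {rmorphism F -> R'}) (f : {rmorphism R -> R'}).
Hypothesis ff : forall c, f (phi c) = phi' c.

Lemma map_lmul_det x : f (lmul_det phi x) = lmul_det phi' (map_mx f x).
Proof. by rewrite /lmul_det -det_map_mx (map_lmul_mx _ _ ff). Qed.
Lemma map_lang_num x : map_mx f (lang_num phi x) = lang_num phi' (map_mx f x).
Proof.
by rewrite /lang_num map_mxM (map_frob phi phi') map_mx_adj (map_lmul_mx _ _ ff).
Qed.
End Morphism.

Lemma map_lang (L L' : fieldType) (phi : {rmorphism F -> L})
    (phi' : {rmorphism F -> L'}) (f : {rmorphism L -> L'}) x :
  (forall c, f (phi c) = phi' c) ->
  map_mx f (lang phi x) = lang phi' (map_mx f x).
Proof.
move=> ff.
by rewrite /lang map_mxZ fmorphV (map_lmul_det ff) (map_lang_num ff).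
Qed.

Hypothesis freeV : row_free (basis_mx v).
Hypothesis closedV : forall i j, exists z : 'rV_m,
  mxvec (v i *m v j) = z *m basis_mx v.
Hypothesis oneV : exists e : 'rV_m, mxvec 1%:M = e *m basis_mx v.

Lemma comb_lang (L : fieldType) (phi : {rmorphism F -> L}) x : lmul_det phi x != 0 ->
  comb v phi x *m comb v phi (lang phi x) = map_mx (frob phi) (comb v phi x).
Proof.
move=> dx; rewrite mulmx_comb // frob_comb // /lang /lang_num -scalemxAl -mulmxA.
by rewrite mul_adj_mx mul_mx_scalar scalerA mulVf // scale1r.
Qed.

(** Cancelling the invertible [comb x] leaves one solution only; this characterisation later yields
    invariance under automorphisms. *)
Lemma langP (L : fieldType) (phi : {rmorphism F -> L}) x y : lmul_det phi x != 0 ->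
  comb v phi x *m comb v phi y = map_mx (frob phi) (comb v phi x) ->
  y = lang phi x.
Proof.
move=> dx; rewrite -(comb_lang dx) => /(can_inj (mulKmx (comb_unit freeV closedV oneV dx))).
by move/(comb_inj freeV).
Qed.

Lemma lmul_det1 (R : comNzRingType) (phi : {rmorphism F -> R}) :
  lmul_det phi (coords v phi 1%:M) = 1.
Proof. by rewrite /lmul_det lmul_mx1 // det1. Qed.

(* On the line [x = 1 + eps z] one has [1 - lang x = eps * w (eps)] with
   [w 0 = z], so the lowest homogeneous part of [p (1 - s)] decides. *)
Lemma lang_dominant (k : fieldType) (phi : {rmorphism F -> k}) (p : {mpoly k[m]}) :
  infinite_field k -> p != 0 ->
  exists u, lmul_det phi u != 0 /\ p.@[fun i => lang phi u 0 i] != 0.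
Proof.
move=> infk p0; set e := coords v phi 1%:M.
(* Recentre at the identity: [Q (s) = p (e - s)]. *)
pose Q : {mpoly k[m]} := mmap (@mpolyC m k) (fun i => (e 0 i)%:MP - 'X_i) p.
have QE s : Q.@[s] = p.@[fun i => e 0 i - s i].
  apply: (rmorph_mmap (f := @mpolyC m k) (g := idfun) (h := meval s)) => [c|i].
    by rewrite /= mevalC.
  by rewrite /= mevalB mevalC mevalXU.
have Q0 : Q != 0.
  have [s ps] := mpoly_nonroot infk p0.
  apply: contraNneq ps => Q0; have := QE (fun i => e 0 i - s i).
  by rewrite Q0 meval0 => ->; apply/eqP/meval_eq => i; rewrite subKr.
have exd : exists d, has (fun a => mdeg a == d) (msupp Q).
  exists (mdeg (mlead Q)); apply/hasP; exists (mlead Q) => //.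
  exact: mlead_supp.
(* [d] is the lowest degree of a monomial of [Q], and [Qd] the homogeneous part of that degree. *)
have [d /hasP[a0 a0Q /eqP a0d] dmin] := ex_minnP exd.
pose Qd := \sum_(a <- msupp Q | mdeg a == d) Q@_a *: 'X_[a].
have Qd0 : Qd != 0.
  apply: contraTneq a0Q => /(congr1 (mcoeff a0)) /eqP.
  rewrite mcoeff0 raddf_sum /= -mcoeff_eq0 => /eqP <-; apply/eqP.
  rewrite [in LHS](mpolyE Q) raddf_sum [LHS](bigID (fun a => mdeg a == d)) /=.
  rewrite [X in _ + X]big1 ?addr0 // => a ad.
  rewrite mcoeffZ mcoeffX; case: eqP => [aa|_]; last by rewrite mulr0.
  by rewrite aa a0d eqxx in ad.
have [z0 zP] := mpoly_nonroot infk Qd0.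
pose z := \row_i z0 i.
pose phiR : {rmorphism F -> {poly k}} := polyC \o phi.
pose q := #|F|.
have q1 : (1 < q)%N by apply: finNzRing_gt1.
(* The line [1 + eps z] over [k[X]], with ['X] as [eps]. Here [x - x^(q) = eps z - eps^q z^(q)]; [W]
   is this divided by [eps], times the adjugate. *)
pose xe : 'rV[{poly k}]_m := map_mx polyC e + 'X *: map_mx polyC z.
pose W : 'rV[{poly k}]_m :=
  (map_mx polyC z - 'X^(q.-1) *: map_mx polyC (map_mx (frob phi) z))
   *m \adj (lmul_mx v phiR xe).
pose D := msize Q.
(* [Q (e - lang x)] along this line, multiplied by a power of the determinant and divided by
   [eps^d]; as no monomial of [Q] has degree below [d], this is a polynomial. *)
pose Psi : {poly k} := \sum_(a <- msupp Q)
   (Q@_a)%:P * ('X^(mdeg a - d) * (lmul_det phiR xe ^+ (D - mdeg a) * mmap1 (W 0) a)).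
have evR c x : horner_eval c (phiR x) = phi x by rewrite /= /horner_eval hornerC.
have xeE c : map_mx (horner_eval c) xe = e + c *: z.
  by apply/rowP=> i; rewrite !mxE /= /horner_eval ?mxE !hornerE.
have WE c : map_mx (horner_eval c) W =
   (z - c ^+ q.-1 *: map_mx (frob phi) z) *m \adj (lmul_mx v phi (e + c *: z)).
  rewrite map_mxM map_mx_adj (map_lmul_mx _ _ (evR c)) xeE; congr (_ *m _).
  by apply/rowP=> i; rewrite !mxE /= /horner_eval ?mxE !hornerE.
have PsiE c : Psi.[c] = \sum_(a <- msupp Q) Q@_a * (c ^+ (mdeg a - d) *
   (lmul_det phi (e + c *: z) ^+ (D - mdeg a) *
    mmap1 ((map_mx (horner_eval c) W) 0) a)).
  rewrite horner_sum; apply: eq_bigr => a _.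
  rewrite !hornerM hornerC horner_exp hornerX horner_exp.
  have -> : (lmul_det phiR xe).[c] = lmul_det phi (e + c *: z).
    by rewrite -[LHS]/(horner_eval c _) (map_lmul_det (evR c)) xeE.
  have -> // : (mmap1 (W 0) a).[c] = mmap1 (map_mx (horner_eval c) W 0) a.
  rewrite -[LHS]/(horner_eval c _) /mmap1 rmorph_prod; apply: eq_bigr => i _.
  by rewrite rmorphXn [in RHS]mxE.
(* At [eps = 0] only the lowest homogeneous part survives, and [Psi] takes the nonzero value
   [Qd (z)]. *)
have Psi0 : Psi != 0.
  apply: contraNneq zP => /(congr1 (horner_eval 0)); rewrite rmorph0 /horner_eval.
  rewrite PsiE scale0r addr0 WE scale0r addr0 lmul_mx1 // adj1 mulmx1.
  rewrite expr0n -subn1 subn_eq0 leqNgt q1 scale0r subr0.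
  move=> <-; rewrite /Qd raddf_sum /= big_mkcond; apply/eqP.
  apply: eq_big_seq => a aQ; rewrite lmul_det1 expr1n mul1r expr0n subn_eq0.
  have da : (d <= mdeg a)%N by apply: dmin; apply/hasP; exists a.
  rewrite eqn_leq da andbT; case: leqP => _; last by rewrite mul0r mulr0.
  rewrite mevalZ mul1r mevalX; congr (_ * _); apply: eq_bigr => i _.
  by rewrite mxE.
have de0 : lmul_det phiR xe != 0.
  apply: contra_eq_neq (map_lmul_det (evR 0) xe) => ->.
  by rewrite xeE scale0r addr0 lmul_det1 rmorph0 eq_sym oner_eq0.
(* One value of [eps] at which [eps], the determinant and [Psi] are all nonzero. *)
have [c cP] : exists c, ('X * (lmul_det phiR xe * Psi)).[c] != 0.
  by apply: (poly_nonroot idfun) => //; rewrite !mulf_neq0 ?polyX_eq0.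
move: cP; rewrite !hornerM hornerX !mulf_eq0 !negb_or => /and3P[c0 dc Psic].
have {dc} dc : lmul_det phi (e + c *: z) != 0.
  by rewrite -xeE -(map_lmul_det (evR c)).
exists (e + c *: z); split=> //; set u := e + c *: z in WE dc *.
have uE : e - lang phi u = c *: ((lmul_det phi u)^-1 *: map_mx (horner_eval c) W).
  have eL : e *m lmul_mx v phi u = u by apply: mul1_lmul.
  have -> : e = (lmul_det phi u)^-1 *: (u *m \adj (lmul_mx v phi u)).
    rewrite -[X in X *m \adj _]eL.
    by rewrite -mulmxA mul_mx_adj mul_mx_scalar scalerA mulVf // scale1r.
  rewrite /lang -scalerBr /lang_num -mulmxBl scalerA mulrC -scalerA; congr (_ *: _).
  rewrite WE scalemxAl; congr (_ *m _).
  rewrite scalerBr scalerA -exprS prednK ?(ltnW q1) //.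
  rewrite /u map_mxD frob_coords1 // opprD addrACA subrr add0r; congr (_ - _).
  by apply/rowP=> i; rewrite !mxE /= /frob ?mxE exprMn.
have : (lmul_det phi u ^+ D) * p.@[fun i => lang phi u 0 i] = c ^+ d * Psi.[c].
  have -> : p.@[fun i => lang phi u 0 i] = Q.@[fun i => (e - lang phi u) 0 i].
    by rewrite QE; apply: meval_eq => i; rewrite !mxE opprB addrC subrK.
  rewrite /meval.
  have -> : mmap idfun (fun i => (e - lang phi u) 0 i) Q =
    mmap idfun (fun i => (lmul_det phi u)^-1 * (c * map_mx (horner_eval c) W 0 i)) Q.
    apply: eq_bigr => a _; congr (_ * _); apply: mmap1_eq => i.
    by rewrite uE !mxE mulrCA.
  rewrite -homog_evalE // PsiE mulr_sumr; apply: eq_big_seq => a aQ.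
  have da : (d <= mdeg a)%N by apply: dmin; apply/hasP; exists a.
  have cE : c ^+ mdeg a = c ^+ d * c ^+ (mdeg a - d) by rewrite -exprD subnKC.
  rewrite mmap1_scale cE [RHS]mulrCA; congr (_ * _).
  by rewrite [LHS]mulrCA -mulrA.
move/eqP; apply: contraTneq => ->.
by rewrite mulr0 eq_sym mulf_neq0 ?expf_neq0.
Qed.

End Lang.

(** * Frobenius-linear polynomials *)

Lemma natr_card (F : finFieldType) (R : comNzRingType) (phi : {rmorphism F -> R}) :
  #|F|%:R = 0 :> R.
Proof.
have [p pr_p pF] := finPcharP F; have pR := rmorph_pchar phi pF.
have : (1 < #|F|)%N by apply: finNzRing_gt1.
rewrite (card_pprimeChar pF) natrX (pcharf0 pR) expr0n.
by case: (logn _ _).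
Qed.

Section Qlin.

Variables (F : finFieldType) (n : nat).

Lemma qlin_polyE (R : nzRingType) (a : 'I_n.+1 -> R) :
  qlin_poly #|F| a = 'X^(#|F| ^ n.+1) + \poly_(j < #|F| ^ n.+1) (qlin_poly #|F| a)`_j.
Proof.
have q1 : (1 < #|F|)%N by apply: finNzRing_gt1.
have coef_qlin j : (#|F| ^ n.+1 <= j)%N ->
    (qlin_poly #|F| a)`_j = (j == #|F| ^ n.+1)%N%:R.
  move=> qj; rewrite coefB coefXn coef_sum big1 ?subr0 // => i _.
  rewrite coefZ coefXn gtn_eqF ?mulr0 //.
  by apply: leq_trans qj; rewrite ltn_exp2l.
apply/polyP=> j; rewrite [RHS]coefD [in RHS]coefXn coef_poly.
case: ltnP => [jq|/coef_qlin->]; last by rewrite addr0.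
by rewrite ltn_eqF ?add0r.
Qed.

Lemma size_qlin (R : nzRingType) (a : 'I_n.+1 -> R) :
  size (qlin_poly #|F| a) = (#|F| ^ n.+1).+1.
Proof. by rewrite qlin_polyE size_polyDl size_polyXn // ltnS size_poly. Qed.

Lemma monic_qlin (R : nzRingType) (a : 'I_n.+1 -> R) : qlin_poly #|F| a \is monic.
Proof.
by rewrite monicE qlin_polyE lead_coefDl ?lead_coefXn // size_polyXn ltnS size_poly.
Qed.

Lemma map_qlin (R R' : nzRingType) (f : {rmorphism R -> R'}) (a : 'I_n.+1 -> R) :
  map_poly f (qlin_poly #|F| a) = qlin_poly #|F| (f \o a).
Proof.
rewrite /qlin_poly rmorphB rmorph_sum /= map_polyXn; congr (_ - _).
by apply: eq_bigr => i _; rewrite map_polyZ map_polyXn.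
Qed.

Lemma map_Delta (R R' : nzRingType) (f : {rmorphism R -> R'}) (a : 'I_n.+1 -> R) :
  map_mx f (Delta_mx a) = Delta_mx (f \o a).
Proof.
apply/matrixP=> i j; rewrite !mxE; case: ifP => // _.
by case: ifP => _; rewrite (rmorph0, rmorph1).
Qed.

(** Every exponent [q^i] with [i > 0] is zero in [R], so only the linear term contributes. *)
Lemma deriv_qlin (R : comNzRingType) (phi : {rmorphism F -> R}) (a : 'I_n.+1 -> R) :
  (qlin_poly #|F| a)^`() = (- a ord0)%:P.
Proof.
have q0 e : (0 < e)%N -> (#|F| ^ e)%:R = 0 :> R.
  by case: e => // e _; rewrite natrX (natr_card phi) expr0n.
have dq e : (0 < e)%N -> ('X^(#|F| ^ e) : {poly R})^`() = 0.
  by move=> e0; rewrite derivXn -mulr_natr -polyC_natr q0 // mulr0.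
rewrite derivB dq // sub0r raddf_sum big_ord_recl /= big1 => [|i _].
  by rewrite addr0 derivZ expn0 derivX polyCN alg_polyC.
by rewrite derivZ dq ?scaler0.
Qed.

(** The first row of [Delta] is zero except for its last entry [a_0]. *)
Lemma Delta_unit_neq0 (L : fieldType) (a : 'I_n.+1 -> L) :
  Delta_mx a \in unitmx -> a ord0 != 0.
Proof.
move=> uD; apply/eqP => a0.
have : delta_mx 0 ord0 *m Delta_mx a = 0 :> 'rV_n.+1.
  by rewrite -rowE; apply/rowP=> j; rewrite !mxE /= a0; case: ifP.
move/(congr1 (mulmx^~ (invmx (Delta_mx a)))); rewrite mulmxK // mul0mx.
by move/rowP/(_ ord0)/eqP; rewrite !mxE eqxx oner_eq0.
Qed.

Lemma separable_qlin (L : fieldType) (phi : {rmorphism F -> L}) (a : 'I_n.+1 -> L) :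
  Delta_mx a \in unitmx -> separable_poly (qlin_poly #|F| a).
Proof.
move/Delta_unit_neq0=> a0; rewrite unlock (deriv_qlin phi).
by rewrite -alg_polyC coprimepZr ?oppr_eq0 // coprimep1.
Qed.

Variables (L : fieldType) (phi : {rmorphism F -> L}) (a : 'I_n.+1 -> L).

(** Off the last column the companion shape makes each entry the [q]-th power of the one before; the
    last column then becomes the polynomial equation for the first entry. *)
Lemma frob_row_root (r : 'rV[L]_n.+1) :
  map_mx (frob phi) r = r *m Delta_mx a ->
  (forall j : 'I_n.+1, r 0 j = r 0 0 ^+ (#|F| ^ j)) /\ root (qlin_poly #|F| a) (r 0 0).
Proof.
move=> fr.
have rS j (lt_j : (j.+1 < n.+1)%N) :
    r 0 (Ordinal lt_j) = frob phi (r 0 (Ordinal (ltnW lt_j))).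
  have /rowP/(_ (Ordinal (ltnW lt_j))) := fr; rewrite !mxE => ->.
  rewrite (bigD1 (Ordinal lt_j)) //= big1 => [|i ij]; rewrite !mxE.
    by rewrite -val_eqE /= ltn_eqF // eqxx mulr1 addr0.
  rewrite -val_eqE /= ltn_eqF //; case: eqP => [ij'|_]; last by rewrite mulr0.
  by case/eqP: ij; apply: val_inj.
have rE (j : 'I_n.+1) : r 0 j = r 0 0 ^+ (#|F| ^ j).
  case: j; elim=> [|j IHj] lt_j /=.
    by rewrite expr1; congr (r 0 _); apply: val_inj.
  by rewrite rS IHj /frob -exprM -expnSr.
split=> //; rewrite /root /qlin_poly hornerD hornerN hornerXn horner_sum subr_eq0.
have /rowP/(_ ord_max) := fr.
rewrite mxE (rE ord_max) /= /frob -exprM -expnSr => ->; rewrite mxE.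
apply/eqP/eq_bigr => i _; rewrite hornerZ hornerXn -rE !mxE eqxx.
by rewrite mulrC.
Qed.

(** The [F]-combinations of the rows of [W] solve the same equation, since Frobenius fixes [F]. A
    solution is determined by its first entry, so these entries are distinct roots, as many as the
    degree. *)
Lemma qlin_split (W : 'M[L]_n.+1) : W \in unitmx ->
  map_mx (frob phi) W = W *m Delta_mx a ->
  qlin_poly #|F| a =
    \prod_(w : 'rV[F]_n.+1) ('X - ((map_mx phi w *m W) 0 0)%:P).
Proof.
move=> uW fW.
have fw (w : 'rV[F]_n.+1) :
    map_mx (frob phi) (map_mx phi w *m W) = (map_mx phi w *m W) *m Delta_mx a.
  by rewrite map_mxM map_frob_id -mulmxA fW.
pose rs := [seq (map_mx phi w *m W) 0 0 | w <- enum {: 'rV[F]_n.+1}].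
have Urs : uniq rs.
  rewrite map_inj_uniq ?enum_uniq // => w w' eq_ww.
  apply: (map_mx_inj (f := phi)); apply: (can_inj (mulmxK uW)).
  have [rw _] := frob_row_root (fw w); have [rw' _] := frob_row_root (fw w').
  by apply/rowP=> j; rewrite rw rw' eq_ww.
have root_rs : all (root (qlin_poly #|F| a)) rs.
  by apply/allP=> _ /mapP[w _ ->]; have [_] := frob_row_root (fw w).
have := all_roots_prod_XsubC _ root_rs.
rewrite size_qlin size_map -cardE card_mx mul1n uniq_rootsE => -> //.
by rewrite (monicP (monic_qlin a)) scale1r big_map big_enum.
Qed.

End Qlin.

(** * Fraction fields and specialisation *)

Section Fraction.

Import generic_quotient.
Local Open Scope quotient_scope.

Lemma frac_numden (R : idomainType) (c : {fraction R}) :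
  c = tofrac (\n_(repr c)) / tofrac (\d_(repr c)).
Proof.
set r := repr c; have dr : tofrac (\d_r) != 0 by rewrite tofrac_eq0 denom_ratioP.
apply: (canRL (mulfK dr)); rewrite -[c]reprK -/r.
rewrite -[LHS]/(FracField.mul _ _).
unlock FracField.tofrac; rewrite -FracField.pi_mul; apply/eqmodP.
rewrite /= FracField.equivfE /FracField.mulf !numden_Ratio ?mulr1 ?oner_neq0 ?denom_ratioP //.
by rewrite mulrC.
Qed.

Lemma fracP (R : idomainType) (c : {fraction R}) :
  exists p q, q != 0 /\ c = tofrac p / tofrac q.
Proof.
exists (\n_(repr c)), (\d_(repr c)).
by split; [apply: denom_ratioP | apply: frac_numden].
Qed.

Variables (R : idomainType) (L : fieldType) (h : {rmorphism R -> L}).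
Hypothesis h_inj : injective h.

(** The value is read off a chosen representative; injectivity of [h] keeps denominators nonzero,
    and [frac_lift_div] gives independence of the representative. *)
Definition frac_lift (c : {fraction R}) : L := h (\n_(repr c)) / h (\d_(repr c)).

Lemma frac_lift_div u w : w != 0 -> frac_lift (tofrac u / tofrac w) = h u / h w.
Proof.
move=> w0; set c := _ / _.
have h0 x : x != 0 -> h x != 0 by rewrite -(inj_eq h_inj) rmorph0.
have d0 : \d_(repr c) != 0 := denom_ratioP _.
have : tofrac u / tofrac w = tofrac (\n_(repr c)) / tofrac (\d_(repr c)).
  by rewrite -frac_numden.
move/eqP; rewrite eqr_div ?tofrac_eq0 // -!tofracM tofrac_eq => /eqP uc.
by apply/eqP; rewrite /frac_lift eqr_div ?h0 // -!rmorphM uc.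
Qed.

Lemma frac_lift_tofrac u : frac_lift (tofrac u) = h u.
Proof.
by rewrite -[tofrac u]divr1 -tofrac1 frac_lift_div ?oner_neq0 // rmorph1 divr1.
Qed.

Fact frac_lift_zmod_morphism : zmod_morphism frac_lift.
Proof.
have h0 x : x != 0 -> h x != 0 by rewrite -(inj_eq h_inj) rmorph0.
move=> x y; rewrite (frac_numden x) (frac_numden y).
move: (denom_ratioP (repr x)) (denom_ratioP (repr y)).
move: (\n_(repr x)) (\d_(repr x)) (\n_(repr y)) (\d_(repr y)) => a b c d b0 d0.
rewrite -mulNr -tofracN addf_div ?tofrac_eq0 // -!tofracM -tofracD.
rewrite !frac_lift_div ?mulf_neq0 // rmorphD !rmorphM rmorphN.
by rewrite -addf_div ?h0 // mulNr.
Qed.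

Fact frac_lift_monoid_morphism : monoid_morphism frac_lift.
Proof.
split; first by rewrite -tofrac1 frac_lift_tofrac rmorph1.
move=> x y; rewrite (frac_numden x) (frac_numden y).
move: (denom_ratioP (repr x)) (denom_ratioP (repr y)).
move: (\n_(repr x)) (\d_(repr x)) (\n_(repr y)) (\d_(repr y)) => a b c d b0 d0.
rewrite mulf_div -!tofracM !frac_lift_div ?mulf_neq0 //.
by rewrite !rmorphM mulf_div.
Qed.

Definition frac_lift_rmorph : {rmorphism {fraction R} -> L} :=
  HB.pack frac_lift
    (GRing.isZmodMorphism.Build _ _ frac_lift frac_lift_zmod_morphism)
    (GRing.isMonoidMorphism.Build _ _ frac_lift frac_lift_monoid_morphism).

End Fraction.

(** * Calculus of specialisations *)

Section Spec.

Variables (F : fieldType) (m : nat) (L : fieldType) (phi : {rmorphism F -> L}).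
Variable (xi : 'I_m -> L).
Local Notation ev := (mmap phi xi).
Local Notation spec := (frac_spec phi xi).

Lemma ev_neq0 w : ev w != 0 -> tofrac w != 0.
Proof. by rewrite tofrac_eq0; apply: contraNneq => ->; rewrite rmorph0. Qed.

Lemma spec_uniq c y y' : spec c y -> spec c y' -> y = y'.
Proof.
move=> [u [w [w0 -> ->]]] [u' [w' [w'0 E ->]]].
move/eqP: E; rewrite eqr_div ?ev_neq0 // -!tofracM tofrac_eq => /eqP E.
by apply/eqP; rewrite eqr_div // -!rmorphM E.
Qed.

Lemma spec_tofrac u : spec (tofrac u) (ev u).
Proof. by exists u, 1; rewrite tofrac1 rmorph1 !divr1 oner_neq0. Qed.

Lemma spec0 : spec 0 0.
Proof. by have := spec_tofrac 0; rewrite tofrac0 rmorph0. Qed.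

Lemma spec1 : spec 1 1.
Proof. by have := spec_tofrac 1; rewrite tofrac1 rmorph1. Qed.

Lemma specD c d x y : spec c x -> spec d y -> spec (c + d) (x + y).
Proof.
move=> [u [w [w0 -> ->]]] [u' [w' [w'0 -> ->]]].
exists (u * w' + u' * w), (w * w'); rewrite rmorphM mulf_neq0 //.
by rewrite !addf_div ?ev_neq0 // !(rmorphM, rmorphD).
Qed.

Lemma specM c d x y : spec c x -> spec d y -> spec (c * d) (x * y).
Proof.
move=> [u [w [w0 -> ->]]] [u' [w' [w'0 -> ->]]].
exists (u * u'), (w * w'); rewrite rmorphM mulf_neq0 //.
by rewrite !mulf_div !rmorphM.
Qed.

Lemma specN c x : spec c x -> spec (- c) (- x).
Proof.
move=> cx; rewrite -(mulN1r c) -(mulN1r x); apply: specM => //.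
by have := spec_tofrac (-1); rewrite !rmorphN !rmorph1.
Qed.

Lemma specX c x i : spec c x -> spec (c ^+ i) (x ^+ i).
Proof.
move=> cx; elim: i => [|i IHi]; first exact: spec1.
by rewrite !exprS; apply: specM.
Qed.

Lemma spec_sum (I : Type) (r : seq I) (P : pred I) c x :
  (forall i, spec (c i) (x i)) ->
  spec (\sum_(i <- r | P i) c i) (\sum_(i <- r | P i) x i).
Proof.
by move=> cx; elim/big_rec2: _ => [|i y z _]; [apply: spec0 | apply: specD].
Qed.

Definition spec_mx p q (A : 'M[ratfun F m]_(p, q)) (B : 'M[L]_(p, q)) :=
  forall i j, spec (A i j) (B i j).

Lemma spec_mulmx p q r (A : 'M_(p, q)) (B : 'M_(q, r)) A' B' :
  spec_mx A A' -> spec_mx B B' -> spec_mx (A *m B) (A' *m B').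
Proof. by move=> AA BB i j; rewrite !mxE; apply: spec_sum => l; apply: specM. Qed.

Lemma spec_mx_uniq p q (A : 'M_(p, q)) B B' : spec_mx A B -> spec_mx A B' -> B = B'.
Proof. by move=> AB AB'; apply/matrixP=> i j; apply: spec_uniq (AB i j) (AB' i j). Qed.

Lemma spec_if (b : bool) c d x y : spec c x -> spec d y ->
  spec (if b then c else d) (if b then x else y).
Proof. by case: b. Qed.

Lemma spec_qlin n q (a : 'I_n.+1 -> ratfun F m) a' :
  (forall i, spec (a i) (a' i)) -> poly_spec phi xi (qlin_poly q a) (qlin_poly q a').
Proof.
move=> aa j; have specb (b : bool) : spec b%:R b%:R.
  by case: b; [apply: spec1 | apply: spec0].
rewrite !coefB !coefXn !coef_sum; apply: specD => //; apply: specN.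
by apply: spec_sum => i; rewrite !coefZ !coefXn; apply: specM.
Qed.

End Spec.

(** A denominator of [c] serves. It is chosen before [L], [phi] and [xi], hence is the same for all
    fields over [F]. *)
Lemma spec_den (F : fieldType) (m : nat) (c : ratfun F m) :
  exists2 d : {mpoly F[m]}, d != 0 &
    forall (L : fieldType) (phi : {rmorphism F -> L}) xi,
      mmap phi xi d != 0 -> exists y, frac_spec phi xi c y.
Proof.
have [p [q [q0 cE]]] := fracP c; exists q => // L phi xi q_xi.
by exists (mmap phi xi p / mmap phi xi q), p, q.
Qed.

Lemma spec_den_fam (F : fieldType) (m : nat) (I : finType) (c : I -> ratfun F m) :
  exists2 d : {mpoly F[m]}, d != 0 &
    forall (L : fieldType) (phi : {rmorphism F -> L}) xi,
      mmap phi xi d != 0 -> exists y, forall i, frac_spec phi xi (c i) (y i).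
Proof.
have /fin_all_exists2[d d0 dP] i := spec_den (c i).
exists (\prod_i d i); first exact/prodf_neq0.
move=> L phi xi; rewrite rmorph_prod => /prodf_neq0 dxi.
have /fin_all_exists[y yP] i : exists y, frac_spec phi xi (c i) y.
  by apply: dP; apply: dxi.
by exists y.
Qed.

(** * Specialising the matrix equation for [Delta] *)

Section Specialize.

Variables (F : finFieldType) (n m : nat) (v : 'I_m -> 'M[F]_n.+1).
Variables (a : 'I_n.+1 -> ratfun F m) (N : 'M[ratfun F m]_n.+1).
Hypothesis uN : N \in unitmx.
Hypothesis AN : invmx N *m generic_mx v *m map_mx (fun x => x ^+ #|F|) N = Delta_mx a.

(** [d] is a common denominator of [N], its inverse and the [a_i]. Since values are unique,
    identities between these matrices survive specialisation. *)
Lemma specialize : exists2 d : {mpoly F[m]}, d != 0 &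
  forall (L : fieldType) (phi : {rmorphism F -> L}) (xi : 'I_m -> L),
    mmap phi xi d != 0 ->
    exists a' N', [/\ poly_spec phi xi (qlin_poly #|F| a) (qlin_poly #|F| a'),
      N' \in unitmx &
      comb v phi (\row_i xi i) *m map_mx (frob phi) N' = N' *m Delta_mx a'].
Proof.
have [d1 d10 d1P] := spec_den_fam (fun ij => N ij.1 ij.2).
have [d2 d20 d2P] := spec_den_fam (fun ij => (invmx N) ij.1 ij.2).
have [d3 d30 d3P] := spec_den_fam a.
exists (d1 * (d2 * d3)); first by rewrite !mulf_neq0.
move=> L phi xi; rewrite !rmorphM !mulf_eq0 !negb_or => /and3P[].
move=> /d1P[N1 N1P] /d2P[M1 M1P] /d3P[a' a'P].
pose N' := \matrix_(i, j) N1 (i, j); pose M' := \matrix_(i, j) M1 (i, j).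
have NP : spec_mx phi xi N N' by move=> i j; rewrite mxE; apply: (N1P (i, j)).
have MP : spec_mx phi xi (invmx N) M' by move=> i j; rewrite mxE; apply: (M1P (i, j)).
(* Both sides are values of [N *m invmx N]; the specialised inverse is what makes [N']
   invertible. *)
have NM : N' *m M' = 1%:M.
  apply: (spec_mx_uniq (spec_mulmx NP MP)); rewrite mulmxV // => i j.
  by rewrite !mxE; case: (i == j); [apply: spec1 | apply: spec0].
exists a', N'; split; first exact: spec_qlin.
  by case/mulmx1_unit: NM.
have fN : spec_mx phi xi (map_mx (fun x => x ^+ #|F|) N) (map_mx (frob phi) N').
  by move=> i j; rewrite !mxE; apply: specX; apply: (N1P (i, j)).
have DP : spec_mx phi xi (Delta_mx a) (Delta_mx a').
  move=> i j; rewrite !mxE; apply: spec_if => //.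
  by apply: spec_if; [apply: spec1 | apply: spec0].
have gP : spec_mx phi xi (generic_mx v) (comb v phi (\row_i xi i)).
  move=> i j; rewrite combE summxE mxE; apply: spec_sum => l; rewrite !mxE.
  apply: specM.
    by have := spec_tofrac phi xi 'X_l; rewrite mmapX mmap1U.
  by have := spec_tofrac phi xi (v l i j)%:MP; rewrite mmapC.
apply: (spec_mx_uniq (spec_mulmx gP fN)).
have -> : generic_mx v *m map_mx (fun x => x ^+ #|F|) N = N *m Delta_mx a.
  by rewrite -AN !mulmxA mulmxV // mul1mx.
exact: spec_mulmx.
Qed.

End Specialize.

(** * Extending a field morphism to a splitting field *)

Lemma vsval_alg (K : fieldType) (E : fieldExtType K) (U : {subfield E}) (c : K) :
  vsval (c%:A : subvs_of U) = c%:A.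
Proof.
have v1 : vsval (1 : subvs_of U) = 1 by exact: (rmorph1 (@vsval _ _ U)).
by rewrite -[in RHS]v1.
Qed.

Section Embed.

Variables (K Om : fieldType) (E : fieldExtType K) (theta : {rmorphism K -> Om}).

(** Write an element as a polynomial in [r] and evaluate at [rho]. Two expressions differ by a
    multiple of the minimal polynomial of [r], whose image vanishes at [rho], so the value is well
    defined. *)
Lemma embed_adjoin (U : {subfield E}) (psi : {rmorphism subvs_of U -> Om}) r rho
    (p : {poly subvs_of U}) :
  minPoly U r = map_poly vsval p -> root (map_poly psi p) rho ->
  exists psi' : {rmorphism subvs_of <<U; r>>%AS -> Om},
    forall x y, vsval y = vsval x -> psi' y = psi x.
Proof.
move=> Dp root_rho.
have fP (y : subvs_of <<U; r>>%AS) :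
    {q : {poly subvs_of U} | vsval y = (map_poly vsval q).[r]}.
  apply: sig_eqW; have /Fadjoin_polyP[q /polyOver_subvs[q' ->] yE] := valP y.
  by exists q'.
pose f y := (map_poly psi (sval (fP y))).[rho].
have fE y q : vsval y = (map_poly vsval q).[r] -> f y = (map_poly psi q).[rho].
  rewrite /f; case: (fP y) => q' /= -> /eqP.
  rewrite -subr_eq0 -hornerN -hornerD -rmorphB => rq.
  have : minPoly U r %| map_poly vsval (q' - q).
    by apply: minPoly_dvdp => //; apply/polyOver_subvs; exists (q' - q).
  rewrite Dp dvdp_map => /dvdpP[s sE].
  apply/eqP; rewrite -subr_eq0 -hornerN -hornerD -rmorphB sE rmorphM hornerM.
  by rewrite (rootP root_rho) mulr0.
have qE y : vsval y = (map_poly vsval (sval (fP y))).[r] by case: (fP y).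
have f_zmod : zmod_morphism f.
  move=> x y; rewrite (fE (x - y) (sval (fP x) - sval (fP y))).
    by rewrite rmorphB hornerD hornerN.
  by rewrite !rmorphB hornerD hornerN /= -!qE.
have f_monoid : monoid_morphism f.
  split; first by rewrite (fE 1 1) ?rmorph1 ?hornerC.
  move=> x y; rewrite (fE (x * y) (sval (fP x) * sval (fP y))).
    by rewrite rmorphM hornerM.
  by rewrite !rmorphM hornerM /= -!qE.
pose f' : {rmorphism subvs_of <<U; r>>%AS -> Om} := HB.pack f
  (GRing.isZmodMorphism.Build _ _ f f_zmod)
  (GRing.isMonoidMorphism.Build _ _ f f_monoid).
exists f' => x y yx; rewrite /= (fE y x%:P) ?map_polyC ?hornerC //.
Qed.

(** The roots are adjoined one at a time. The final field is a variable [V], equal to the generated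
    field as a space, so that it keeps its type while the base [U] grows. *)
Lemma embed_adjoin_seq g (rs : seq E) (rs' : seq Om) :
  map_poly theta g %= \prod_(z <- rs') ('X - z%:P) ->
  all (root (map_poly (in_alg E) g)) rs ->
  forall (U V : {subfield E}) (psi : {rmorphism subvs_of U -> Om}),
  (forall c x, vsval x = c%:A -> psi x = theta c) ->
  V = <<U & rs>>%VS :> {vspace E} ->
  exists psi' : {rmorphism subvs_of V -> Om},
    forall c x, vsval x = c%:A -> psi' x = theta c.
Proof.
move=> g_split; elim: rs => [|r rs IHrs] /= => [_|/andP[root_r root_rs]] U V psi psiK.
  rewrite Fadjoin_nil => VU; have -> : V = U by apply: val_inj.
  by exists psi.
rewrite adjoin_cons => VU.
have [p Dp] := polyOver_subvs (minPolyOver U r).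
have [q Dq] : exists q : {poly subvs_of U}, map_poly (in_alg E) g = map_poly vsval q.
  exists (map_poly (in_alg _) g); rewrite -map_poly_comp.
  by apply: eq_map_poly => c; apply: esym (vsval_alg U c).
have psiq : map_poly psi q = map_poly theta g.
  apply/polyP=> i; rewrite !coef_map; apply: psiK.
  by have /(congr1 (fun s : {poly E} => s`_i)) := Dq; rewrite !coef_map.
(* The minimal polynomial divides [g], so its image divides a product of linear factors and, having
   positive degree, has a root. *)
have pq : map_poly psi p %| \prod_(z <- rs') ('X - z%:P).
  rewrite -(eqp_dvdr _ g_split) -psiq dvdp_map -(dvdp_map (@vsval _ _ U)) -Dp -Dq.
  by apply: minPoly_dvdp => //; apply/polyOver_subvs; exists q.
have [b pb] := dvdp_prod_XsubC pq.
have [rho root_rho] : exists rho, root (map_poly psi p) rho.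
  exists (mask b rs')`_0; rewrite (eqp_root pb) root_prod_XsubC mem_nth //.
  rewrite -ltnS -(size_prod_XsubC _ id) -(eqp_size pb) size_map_poly.
  by rewrite -(size_map_poly (@vsval _ _ U)) -Dp size_minPoly ltnS.
have [psi' psi'E] := embed_adjoin Dp root_rho.
apply: (IHrs root_rs <<U; r>>%AS V psi') => // c x xc.
have -> : psi' x = psi (c%:A) by apply: psi'E; rewrite xc; apply: esym (vsval_alg U c).
by apply: psiK; apply: vsval_alg.
Qed.

Lemma embed_splitting g (rs : seq E) (rs' : seq Om) :
  map_poly theta g %= \prod_(z <- rs') ('X - z%:P) ->
  map_poly (in_alg E) g %= \prod_(z <- rs) ('X - z%:P) ->
  <<1 & rs>>%VS = fullv ->
  exists psi : {rmorphism E -> Om}, forall c, psi c%:A = theta c.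
Proof.
move=> g_split' g_split genE.
(* The induction starts from the subfield [1], a copy of [K], to which [theta] is transported. *)
have cP (x : subvs_of (1%AS : {subfield E})) : {c | vsval x = c%:A}.
  by apply: sig_eqW; apply/vlineP/(valP x).
pose f x := theta (sval (cP x)).
have fE x c : vsval x = c%:A -> f x = theta c.
  by rewrite /f; case: (cP x) => d /= -> /(fmorph_inj (in_alg E)) ->.
have cE x : vsval x = (sval (cP x))%:A by case: (cP x).
have f_zmod : zmod_morphism f.
  move=> x y; rewrite -rmorphB; apply: fE.
  by rewrite rmorphB /= scalerBl -!cE.
have f_monoid : monoid_morphism f.
  split; first by rewrite (fE 1 1) ?rmorph1 // scale1r.
  move=> x y; rewrite -rmorphM; apply: fE.
  by rewrite rmorphM /= -scalerA -cE -mulr_algl -cE.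
pose f' : {rmorphism subvs_of (1%AS : {subfield E}) -> Om} := HB.pack f
  (GRing.isZmodMorphism.Build _ _ f f_zmod)
  (GRing.isMonoidMorphism.Build _ _ f f_monoid).
have roots_rs : all (root (map_poly (in_alg E) g)) rs.
  by apply/allP=> z zrs; rewrite (eqp_root g_split) root_prod_XsubC.
have [|psi psiE] := embed_adjoin_seq g_split' roots_rs (V := fullv%AS) (psi := f') _ (esym genE).
  by move=> c x; apply: fE.
pose h (e : E) := psi (Subvs (memvf e)).
have h_zmod : zmod_morphism h.
  by move=> x y; rewrite /h -rmorphB; congr (psi _); apply: val_inj.
have h_monoid : monoid_morphism h.
  split.
    by rewrite /h -[RHS](rmorph1 psi); congr (psi _); apply/val_inj/esym/(rmorph1 vsval).
  by move=> x y; rewrite /h -rmorphM; congr (psi _); apply: val_inj.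
pose h' : {rmorphism E -> Om} := HB.pack h
  (GRing.isZmodMorphism.Build _ _ h h_zmod)
  (GRing.isMonoidMorphism.Build _ _ h h_monoid).
by exists h' => c; apply: psiE.
Qed.

End Embed.

(** * Galois descent *)

Section Algebra.

Variables (F : finFieldType) (n m : nat) (v : 'I_m -> 'M[F]_n.+1).
Local Notation S := <<map v (enum 'I_m)>>%VS.
Local Notation X := (map_tuple v (ord_tuple m)).

Lemma nth_basis (i : 'I_m) : X`_i = v i.
Proof. by rewrite -tnth_nth tnth_map tnth_ord_tuple. Qed.

Lemma span_basis_mx (Z : 'M[F]_n.+1) :
  reflect (exists z : 'rV_m, mxvec Z = z *m basis_mx v) (Z \in S).
Proof.
rewrite -[map v (enum 'I_m)]/(tval X); apply: (iffP idP) => [ZS|[z zE]].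
  exists (\row_i coord X i Z); rewrite {1}(coord_span ZS) linear_sum mulmx_sum_row.
  by apply: eq_bigr => i _; rewrite linearZ /= nth_basis mxE rowK.
rewrite -(mxvecK Z) zE mulmx_sum_row linear_sum; apply: memv_suml => i _.
rewrite linearZ rowK /= mxvecK -nth_basis; apply: memvZ; apply: memv_span.
by rewrite mem_nth // size_tuple.
Qed.

Lemma free_basis_mx : free (map v (enum 'I_m)) -> row_free (basis_mx v).
Proof.
rewrite -[map v (enum 'I_m)]/(tval X) => /freeP frX; apply: inj_row_free => z z0.
apply/rowP=> i; rewrite mxE; apply: (frX (fun i => z 0 i)).
transitivity (vec_mx (z *m basis_mx v)); last by rewrite z0 linear0.
rewrite mulmx_sum_row linear_sum; apply: eq_bigr => j _.
by rewrite linearZ rowK /= mxvecK nth_basis.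
Qed.

Hypothesis freeS : free (map v (enum 'I_m)).
Hypothesis oneS : 1 \in S.
Hypothesis mulS : forall x y, x \in S -> y \in S -> x * y \in S.

Lemma mem_basis i : v i \in S.
Proof. by apply: memv_span; apply: map_f; rewrite mem_enum. Qed.

Lemma closed_basis_mx i j : exists z : 'rV_m, mxvec (v i *m v j) = z *m basis_mx v.
Proof. by apply/span_basis_mx; apply: mulS; apply: mem_basis. Qed.

Lemma one_basis_mx : exists e : 'rV_m, mxvec 1%:M = e *m basis_mx v.
Proof. exact/span_basis_mx. Qed.

Lemma mem_comb (R : comNzRingType) (phi : {rmorphism F -> R}) (Z : 'M[F]_n.+1) :
  Z \in S -> comb v phi (coords v phi (map_mx phi Z)) = map_mx phi Z.
Proof.
move/span_basis_mx=> [z zE]; have -> : map_mx phi Z = comb v phi (map_mx phi z).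
  by rewrite /comb -map_mxM -zE map_mxvec mxvecK.
by rewrite combK ?free_basis_mx.
Qed.

Lemma comb_mem (R : comNzRingType) (phi : {rmorphism F -> R}) (z : 'rV[F]_m) :
  exists2 Z, Z \in S & comb v phi (map_mx phi z) = map_mx phi Z.
Proof.
exists (vec_mx (z *m basis_mx v)); first by apply/span_basis_mx; exists z; rewrite vec_mxK.
by rewrite /comb -map_mxM map_vec_mx.
Qed.

End Algebra.

(** * Twisted points over a Galois extension *)

Section Descent.

Variables (F : finFieldType) (n m : nat) (v : 'I_m -> 'M[F]_n.+1).
Local Notation S := <<map v (enum 'I_m)>>%VS.
Hypothesis freeS : free (map v (enum 'I_m)).
Hypothesis oneS : 1 \in S.
Hypothesis mulS : forall x y, x \in S -> y \in S -> x * y \in S.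
Let freeV := free_basis_mx freeS.
Let closedV := closed_basis_mx mulS.
Let oneV := one_basis_mx oneS.

Variables (L : fieldType) (M : splittingFieldType L) (phi : {rmorphism F -> L}).
Hypothesis infL : infinite_field L.
Hypothesis galoisM : galois 1%VS {:M}.
Let G := 'Gal({:M} / 1%AS)%g.
Let phiM : {rmorphism F -> M} := in_alg M \o phi.
Variable C : gal_of {:M} -> 'M[F]_n.+1.
Hypothesis C_S : {in G, forall s, C s \in S}.
Hypothesis C_unit : {in G, forall s, C s \in unitmx}.
Hypothesis C_mul : {in G &, forall s t, C (s * t)%g = C s *m C t}.
Local Notation CM s := (map_mx phiM (C s)).

Lemma gal_alg (s : gal_of {:M}) c : s c%:A = c%:A.
Proof. exact: rmorph_alg. Qed.

Lemma gal_phiM (s : gal_of {:M}) c : s (phiM c) = phiM c.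
Proof. exact: gal_alg. Qed.

(** The fixed points of the semilinear action in which [t] acts as [(C t)^-1] after [t]; they form
    an [L]-subspace. *)
Definition twisted (y : 'rV[M]_m) :=
  forall t, t \in G -> map_mx t (comb v phiM y) = CM t *m comb v phiM y.

Lemma twisted0 : twisted 0.
Proof. by move=> t _; rewrite comb0 mulmx0 map_mx0. Qed.

Lemma twistedD y z (c : L) : twisted y -> twisted z -> twisted (y + c%:A *: z).
Proof.
move=> ty tz t tG; rewrite combD combZ map_mxD map_mxZ ty // tz //.
by rewrite /= gal_alg mulmxDr scalemxAr.
Qed.

(** The sum of [b] over the twisted action, the analogue of a trace. *)
Definition descend (b : 'rV[M]_m) : 'rV[M]_m :=
  \sum_(s in G) coords v phiM (CM s^-1%g *m map_mx s (comb v phiM b)).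

Lemma comb_descend b : comb v phiM (descend b) =
  \sum_(s in G) CM s^-1%g *m map_mx s (comb v phiM b).
Proof.
rewrite comb_sum; apply: eq_bigr => s sG.
rewrite (map_comb _ _ (gal_phiM s)) -(mem_comb freeS phiM (C_S _)) ?groupV //.
exact: comb_mul.
Qed.

Lemma twisted_descend b : twisted (descend b).
Proof.
move=> t tG; rewrite comb_descend map_mx_sum mulmx_sumr.
rewrite [RHS](reindex_inj (mulIg t)) /=; apply: eq_big => [s|s sG].
  by rewrite groupMr.
rewrite mulmxA -map_mxM -C_mul ?groupV ?groupM // invMg mulKVg map_mxM.
congr (_ *m _).
  by apply/matrixP=> i j; rewrite !mxE /= gal_phiM.
by apply/matrixP=> i j; rewrite !mxE /= galM ?memvf.
Qed.

(** Independence of automorphisms: the matrix of conjugates [s (w_j)] is invertible, so some [g]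
    makes [sum_j g_j s (w_j)] equal to [1] for [s = 1] and to [0] otherwise. In the combination of
    the averages of the [w_j u] only the identity term [u] is left. *)
Lemma descend_span u : exists (g : 'I_#|G| -> M) (w : 'I_#|G| -> M),
  u = \sum_j g j *: descend (w j *: u).
Proof.
have [w _ [uw _ _]] := gal_matrix G; set A := \matrix_(i, j) _ in uw.
have AE i j : A i j = enum_val i (tnth w j) by rewrite mxE.
have G1 : 1%g \in G by apply: group1.
pose i0 := enum_rank_in G1 1%g.
pose g := invmx A *m delta_mx i0 (0 : 'I_1).
exists (fun j => g j 0), (tnth w); apply: (comb_inj freeV (phi := phiM)).
rewrite comb_sum; under eq_bigr => j _ do rewrite combZ comb_descend scaler_sumr.
rewrite exchange_big /= (bigD1 1%g) //= [X in _ + X]big1 ?addr0 => [|s /andP[sG s1]].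
  have Ag : \sum_j g j 0 * tnth w j = 1.
    have /matrixP/(_ i0 0) : A *m g = delta_mx i0 0 by rewrite mulKVmx.
    rewrite mxE [RHS]mxE !eqxx => E; apply: etrans E; apply: eq_bigr => j _.
    by rewrite AE enum_rankK_in // gal_id mulrC.
  under eq_bigr => j _ do rewrite combZ.
  have C1 : C 1%g = 1%:M.
    have := C_mul G1 G1; rewrite mulg1 => /(congr1 (mulmx (invmx (C 1%g)))).
    by rewrite mulKmx ?mulVmx ?C_unit.
  rewrite invg1 C1 map_mx1; under eq_bigr => j _ do rewrite mul1mx.
  rewrite -[LHS]scale1r -Ag scaler_suml; apply: eq_bigr => j _.
  by rewrite -scalerA; congr (_ *: _); apply/matrixP=> a b; rewrite [RHS]mxE gal_id mxE.
have Ag : \sum_j g j 0 * s (tnth w j) = 0.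
  have /matrixP/(_ (enum_rank_in G1 s) 0) : A *m g = delta_mx i0 0 by rewrite mulKVmx.
  rewrite mxE [RHS]mxE; have -> : (enum_rank_in G1 s == i0) = false.
    apply: contraNF s1 => /eqP/(congr1 enum_val).
    by rewrite !enum_rankK_in // => ->.
  move=> E; apply: etrans E; apply: eq_bigr => j _.
  by rewrite AE enum_rankK_in // mulrC.
have -> : \sum_(j < #|G|) g j 0 *: (CM s^-1%g *m map_mx s (comb v phiM (tnth w j *: u)))
   = (\sum_j g j 0 * s (tnth w j)) *: (CM s^-1%g *m map_mx s (comb v phiM u)).
  rewrite scaler_suml; apply: eq_bigr => j _.
  by rewrite combZ map_mxZ -scalemxAr scalerA.
by rewrite Ag scale0r.
Qed.

(** The coefficients [g j] lie in [M], whereas twisted vectors are stable under [L]-combinations.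
    They are replaced by scalars of [L] one at a time, keeping [H] nonzero. *)
Lemma perturb (H : {mpoly M[m]}) (J : Type) (r : seq J) (g : J -> M)
    (s : J -> 'rV[M]_m) x :
  (forall j, twisted (s j)) ->
  H.@[fun i => (x + \sum_(j <- r) g j *: s j) 0 i] != 0 ->
  exists y, twisted y /\ H.@[fun i => (x + y) 0 i] != 0.
Proof.
move=> ts; elim: r x => [|j r IHr] x.
  by rewrite big_nil => Hx; exists 0; split; first exact: twisted0.
rewrite big_cons addrA => /IHr[y [ty Hy]].
(* [H] along the line in direction [s j]; not the zero polynomial, as its value at [g j] is
   nonzero. *)
pose p : {poly M} := mmap polyC
  (fun i => ((x + y) 0 i)%:P + 'X * (s j 0 i)%:P) H.
have pE c : p.[c] = H.@[fun i => (x + (y + c *: s j)) 0 i].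
  rewrite -[LHS]/(horner_eval c p).
  apply: (rmorph_mmap (f := @polyC M) (g := idfun)) => [b|i].
    by rewrite /= /horner_eval hornerC.
  by rewrite /= /horner_eval !hornerE !mxE ?addrA.
have [|z pz] := poly_nonroot (in_alg M) (p := p) infL.
  apply: contraNneq Hy => p0; have := pE (g j); rewrite p0 horner0 => E.
  rewrite E; apply/eqP/meval_eq => i.
  by rewrite addrAC addrA.
exists (y + z%:A *: s j); split; first exact: twistedD.
by rewrite -pE.
Qed.

Lemma twisted_dense (H : {mpoly M[m]}) : H != 0 ->
  exists y, twisted y /\ H.@[fun i => y 0 i] != 0.
Proof.
move=> H0; have infM := infinite_rmorph (in_alg M) infL.
have [u0 Hu] := mpoly_nonroot infM H0.
have [g [w uE]] := descend_span (\row_i u0 i).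
have [||y [ty Hy]] := @perturb H _ (index_enum _) g
   (fun j => descend (w j *: \row_i u0 i)) 0.
- by move=> j; apply: twisted_descend.
- rewrite add0r -uE; move: Hu; congr (_ != 0).
  by apply: meval_eq => i; rewrite mxE.
exists y; split=> //; move: Hy; congr (_ != 0).
by apply: meval_eq => i; rewrite add0r.
Qed.

Lemma gal_fixed (x : M) : (forall s, s \in G -> s x = x) -> exists c, x = c%:A.
Proof.
move=> fx; apply/vlineP; rewrite -[<[1]>%VS]/(asval (1%AS : {subfield M})).
rewrite -(galois_fixedField galoisM); apply/fixedFieldP => //.
exact: memvf.
Qed.

(** Applying [s] to [X l = X^(q)] multiplies [X] and [X^(q)] by [C s], whose entries Frobenius
    fixes. Hence [s l] solves the same equation as [l], and Galois invariants lie in [L]. *)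
Lemma twisted_lang y : twisted y -> lmul_det v phiM y != 0 ->
  exists xi : 'rV[L]_m, lang v phiM y = map_mx (in_alg M) xi.
Proof.
move=> ty dy.
have fixl s : s \in G -> map_mx s (lang v phiM y) = lang v phiM y.
  move=> sG; apply: (langP freeV closedV oneV dy).
  have uC : CM s \in unitmx by rewrite map_unitmx C_unit.
  apply: (can_inj (mulKmx uC)); rewrite mulmxA -ty //.
  rewrite -(map_comb _ _ (gal_phiM s)) -map_mxM comb_lang // (map_frob phiM phiM) ty //.
  by rewrite map_mxM map_frob_id.
have /fin_all_exists[xi xiE] i : exists c, lang v phiM y 0 i = c%:A.
  by apply: gal_fixed => s sG; rewrite -[in RHS](fixl s sG) [RHS]mxE.
by exists (\row_i xi i); apply/rowP=> i; rewrite xiE [RHS]mxE mxE.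
Qed.

Lemma twisted_lang_dense (d : {mpoly F[m]}) : d != 0 ->
  exists y (xi : 'rV[L]_m), [/\ twisted y, lmul_det v phiM y != 0,
    lang v phiM y = map_mx (in_alg M) xi & mmap phi (fun i => xi 0 i) d != 0].
Proof.
move=> d0; have infM := infinite_rmorph (in_alg M) infL.
pose P := map_mpoly phiM d.
have PE x : P.@[x] = mmap phiM x d.
  apply: (rmorph_mmap (f := @mpolyC m M \o phiM)) => [c|i] /=.
    by rewrite mevalC.
  by rewrite mevalXU.
have P0 : P != 0.
  apply: contraNneq d0 => P0; apply/eqP/mpolyP=> a; apply: (fmorph_inj phiM).
  by rewrite -mcoeff_map_mpoly -/P P0 !mcoeff0 rmorph0.
have [u [du Pu]] := lang_dominant freeV closedV oneV phiM infM P0.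
pose psi : {rmorphism F -> {mpoly M[m]}} := @mpolyC m M \o phiM.
pose gen : 'rV[{mpoly M[m]}]_m := \row_i 'X_i.
(* With denominators cleared, [H] is nonzero at [x] exactly when the determinant is nonzero there
   and [d] does not vanish at the Lang image. Dominance over [M] gives [H != 0], and density of
   twisted points applies to it. *)
pose H := lmul_det v psi gen *
  homog_eval psi d (msize d) (lmul_det v psi gen) (lang_num v psi gen 0).
have HE (x : 'rV[M]_m) : H.@[fun i => x 0 i] =
    lmul_det v phiM x * homog_eval phiM d (msize d) (lmul_det v phiM x) (lang_num v phiM x 0).
  have ff c : meval (fun i => x 0 i) (psi c) = phiM c by rewrite /= mevalC.
  have gx : map_mx (meval (fun i => x 0 i)) gen = x.
    by apply/rowP=> i; rewrite !mxE mevalXU.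
  rewrite mevalM (map_lmul_det v ff) gx; congr (_ * _).
  have <- : meval (fun i => x 0 i) (lmul_det v psi gen) = lmul_det v phiM x.
    by rewrite (map_lmul_det v ff) gx.
  apply: rmorph_homog_eval => // i.
  by rewrite -[in RHS]gx -(map_lang_num v ff) [RHS]mxE.
have HE' (x : 'rV[M]_m) : lmul_det v phiM x != 0 -> H.@[fun i => x 0 i] =
    lmul_det v phiM x * (lmul_det v phiM x ^+ msize d * mmap phiM (fun i => lang v phiM x 0 i) d).
  move=> dx; rewrite HE homog_evalE //; congr (_ * (_ * _)).
  by apply: eq_bigr => a _; congr (_ * _); apply: mmap1_eq => i; rewrite [RHS]mxE.
have H0 : H != 0.
  apply: contraNneq Pu => H0; move: (HE' _ du); rewrite H0 meval0 => /esym/eqP.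
  by rewrite !mulf_eq0 expf_eq0 (negPf du) andbF PE.
have [y [ty Hy]] := twisted_dense H0.
have dy : lmul_det v phiM y != 0.
  by apply: contraNneq Hy => dy; rewrite HE dy mul0r.
have [xi xiE] := twisted_lang ty dy.
exists y, xi; split=> //; apply: contraNneq Hy => dxi.
rewrite HE' // xiE; have <- : in_alg M (mmap phi (fun i => xi 0 i) d) =
    mmap phiM (fun i => map_mx (in_alg M) xi 0 i) d.
  by apply: rmorph_mmap => // i; rewrite mxE.
by rewrite dxi rmorph0 !mulr0.
Qed.

End Descent.

(** * Solutions of the Frobenius equation *)

Section Solutions.

Variables (F : finFieldType) (n m : nat) (v : 'I_m -> 'M[F]_n.+1).
Local Notation S := <<map v (enum 'I_m)>>%VS.
Hypothesis freeS : free (map v (enum 'I_m)).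
Hypothesis oneS : 1 \in S.
Hypothesis mulS : forall x y, x \in S -> y \in S -> x * y \in S.
Let freeV := free_basis_mx freeS.
Let closedV := closed_basis_mx mulS.
Let oneV := one_basis_mx oneS.

(** With [X^(q) = X A], the equation for [N'] gives [(X N')^(q) = X A N'^(q) = X N' Delta]. *)
Lemma solution_frob (L : fieldType) (phi : {rmorphism F -> L}) y N'
    (a' : 'I_n.+1 -> L) :
  lmul_det v phi y != 0 ->
  comb v phi (lang v phi y) *m map_mx (frob phi) N' = N' *m Delta_mx a' ->
  map_mx (frob phi) (comb v phi y *m N') = (comb v phi y *m N') *m Delta_mx a'.
Proof. by move=> dy AN; rewrite map_mxM -comb_lang // -!mulmxA AN. Qed.

Lemma solution_unit (L : fieldType) (phi : {rmorphism F -> L}) y N' :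
  lmul_det v phi y != 0 -> N' \in unitmx -> comb v phi y *m N' \in unitmx.
Proof. by move=> dy uN; rewrite unitmx_mul uN (comb_unit freeV closedV oneV). Qed.

(** The quotient of the two elements lies in the algebra and is fixed by Frobenius, so its entries
    come from [F]. *)
Lemma lang_fiber (L : fieldType) (phi : {rmorphism F -> L}) y1 y2 :
  lmul_det v phi y1 != 0 -> lmul_det v phi y2 != 0 -> lang v phi y1 = lang v phi y2 ->
  exists u : {'GL_n.+1[F]}, u \in alg_units S /\
    comb v phi y2 = map_mx phi (GLval u) *m comb v phi y1.
Proof.
move=> d1 d2 l12; have [z [y1z zy1]] := comb_inv freeV closedV oneV d1.
have u1 : comb v phi y1 \in unitmx := comb_unit freeV closedV oneV d1.
have u2 : comb v phi y2 \in unitmx := comb_unit freeV closedV oneV d2.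
have [c cE] := comb_mulP phi closedV y2 z.
have cy1 : comb v phi c *m comb v phi y1 = comb v phi y2.
  by rewrite -cE -mulmxA zy1 mulmx1.
have fc : map_mx (frob phi) c = c.
  apply: (comb_inj freeV (phi := phi)); rewrite -frob_comb.
  have uf : map_mx (frob phi) (comb v phi y1) \in unitmx by rewrite map_unitmx.
  apply: (can_inj (mulmxK uf)); rewrite -map_mxM cy1.
  rewrite -(comb_lang freeV closedV d1) -(comb_lang freeV closedV d2) -l12.
  by rewrite mulmxA cy1.
have [c0 c0E] := frob_fixed_mx fc.
have [C CS CE] := comb_mem v phi c0.
have uC : (C : 'M_n.+1) \is a GRing.unit.
  have : map_mx phi C \in unitmx.
    rewrite -CE -c0E; have : comb v phi c *m comb v phi y1 \in unitmx by rewrite cy1.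
    by rewrite unitmx_mul => /andP[].
  by rewrite map_unitmx.
pose u : {'GL_n.+1[F]} := FinRing.Unit uC; have uE : GLval u = C by [].
exists u; split; first by rewrite in_set uE.
by rewrite uE -CE -c0E cy1.
Qed.

End Solutions.

Lemma gal_eq1 (K : fieldType) (E : splittingFieldType K) (s : gal_of {:E}) (rs : seq E) :
  <<1 & rs>>%VS = fullv -> (forall r, r \in rs -> s r = r) -> s = 1%g.
Proof.
move=> genE fix_rs; apply/eqP/gal_eqP => a _; rewrite gal_id.
have : a \in fixedField [set s].
  have : (<<1 & rs>> <= fixedField [set s])%VS.
    apply/Fadjoin_seqP; split; first exact: sub1v.
    by move=> r /fix_rs sr; apply/fixedFieldP=> [|_ /set1P->]; rewrite ?memvf.
  by rewrite genE => /subvP; apply; apply: memvf.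
by case/mem_fixedFieldP=> _; apply; rewrite set11.
Qed.

(** * The splitting field generated by a solution *)

Section Generic.

Variables (F : finFieldType) (n m : nat) (v : 'I_m -> 'M[F]_n.+1).
Local Notation S := <<map v (enum 'I_m)>>%VS.
Hypothesis freeS : free (map v (enum 'I_m)).
Hypothesis oneS : 1 \in S.
Hypothesis mulS : forall x y, x \in S -> y \in S -> x * y \in S.
Let freeV := free_basis_mx freeS.
Let closedV := closed_basis_mx mulS.
Let oneV := one_basis_mx oneS.

Variables (L : fieldType) (M : splittingFieldType L) (phi : {rmorphism F -> L}).
Let phiM : {rmorphism F -> M} := in_alg M \o phi.
Variables (y : 'rV[M]_m) (xi : 'rV[L]_m) (a' : 'I_n.+1 -> L) (N' : 'M[L]_n.+1).
Hypothesis dy : lmul_det v phiM y != 0.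
Hypothesis yE : lang v phiM y = map_mx (in_alg M) xi.
Hypothesis uN : N' \in unitmx.
Hypothesis AN : comb v phi xi *m map_mx (frob phi) N' = N' *m Delta_mx a'.

Let W := comb v phiM y *m map_mx (in_alg M) N'.

Lemma over_frob : map_mx (frob phiM) W = W *m Delta_mx (in_alg M \o a').
Proof.
apply: solution_frob => //; rewrite yE.
rewrite -(map_comb (phi := phi) v (f := in_alg M)) // -(map_frob phi phiM) -map_mxM AN.
by rewrite map_mxM map_Delta.
Qed.

Lemma over_unit : W \in unitmx.
Proof. by apply: solution_unit => //; rewrite map_unitmx. Qed.

Lemma over_split : map_poly (in_alg M) (qlin_poly #|F| a') =
  \prod_(w : 'rV[F]_n.+1) ('X - ((map_mx phiM w *m W) 0 0)%:P).
Proof. by rewrite map_qlin; apply: qlin_split over_unit over_frob. Qed.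

Lemma over_power i j : W i j = W i 0 ^+ (#|F| ^ j).
Proof.
have : map_mx (frob phiM) (row i W) = row i W *m Delta_mx (in_alg M \o a').
  by rewrite map_row over_frob row_mul.
by case/frob_row_root=> /(_ j); rewrite !mxE.
Qed.

(** The roots are the [F]-combinations of the first column of [W = X N']. That column determines [W]
    by powers, and [N'] has entries in [L], so fixing the roots amounts to fixing [X]. *)
Lemma over_gal (s : gal_of {:M}) : map_mx s (comb v phiM y) = comb v phiM y <->
  forall w : 'rV[F]_n.+1, s ((map_mx phiM w *m W) 0 0) = (map_mx phiM w *m W) 0 0.
Proof.
have sN : map_mx s (map_mx (in_alg M) N') = map_mx (in_alg M) N'.
  by apply/matrixP=> i j; rewrite !mxE; apply: gal_alg.
split=> [sy w|sW].
  have sw : map_mx s (map_mx phiM w *m W) = map_mx phiM w *m W.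
    rewrite !map_mxM sN sy; congr (_ *m _).
    by apply/matrixP=> i j; rewrite !mxE; apply: gal_alg.
  by rewrite -[in RHS]sw [in RHS]mxE.
have sW0 i : s (W i 0) = W i 0.
  have := sW (delta_mx 0 i).
  by rewrite map_delta_mx -rowE mxE.
have sWW : map_mx s W = W.
  by apply/matrixP=> i j; rewrite mxE (over_power i j) rmorphXn /= sW0.
have uNM : map_mx (in_alg M) N' \in unitmx by rewrite map_unitmx.
by apply: (can_inj (mulmxK uNM)); rewrite -[in LHS]sN -map_mxM.
Qed.

(** An automorphism fixing all roots fixes [X] and so is trivial; by the Galois correspondence the
    roots generate [M]. *)
Lemma over_splitting : galois 1%VS {:M} ->
  (forall s : gal_of {:M}, map_mx s (comb v phiM y) = comb v phiM y -> s = 1%g) ->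
  splittingFieldFor 1%VS (map_poly (in_alg M) (qlin_poly #|F| a')) fullv.
Proof.
move=> galM1 sP.
pose rs := [seq (map_mx phiM w *m W) 0 0 | w <- index_enum {: 'rV[F]_n.+1}].
exists rs; first by rewrite over_split big_map eqpxx.
pose K' := [aspace of <<1 & rs>>%VS].
rewrite -[LHS]/(asval K').
have gK : galois K' {:M} by apply: galoisS galM1; rewrite sub1v subvf.
rewrite -[LHS](galois_fixedField gK).
suff -> : 'Gal({:M} / K')%g = 1%g.
  apply/eqP; rewrite eqEsubv subvf /=; apply/subvP=> x _.
  by apply/fixedFieldP=> [|s /set1P->]; rewrite ?memvf ?gal_id.
apply/trivgP/subsetP=> s sG; apply/set1P/sP/over_gal => w.
apply: (fixed_gal _ sG); first exact: subvf.
by apply: seqv_sub_adjoin; apply: map_f; rewrite mem_index_enum.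
Qed.

End Generic.

(** * Extensions with the given group as specialisations *)

Section Case2.
Variables (F : finFieldType) (n m : nat) (v : 'I_m -> 'M[F]_n.+1).
Local Notation S := <<map v (enum 'I_m)>>%VS.
Hypothesis freeS : free (map v (enum 'I_m)).
Hypothesis oneS : 1 \in S.
Hypothesis mulS : forall x y, x \in S -> y \in S -> x * y \in S.
Variables (a : 'I_n.+1 -> ratfun F m) (N : 'M[ratfun F m]_n.+1).
Hypothesis uN : N \in unitmx.
Hypothesis AN : invmx N *m generic_mx v *m map_mx (fun x => x ^+ #|F|) N = Delta_mx a.

Lemma alg_units_group_set : group_set (alg_units S).
Proof.
apply/group_setP; split=> [|x y]; first by rewrite in_set GL_1E.
by rewrite !in_set GL_ME; apply: mulS.
Qed.

Lemma generic_extension (L : fieldType) (phi : {rmorphism F -> L})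
    (M : splittingFieldType L) :
  infinite_field L -> galois 1%VS {:M} ->
  'Gal({:M} / 1%AS) \isog alg_units S ->
  exists (xi : 'I_m -> L) (g : {poly L}), poly_spec phi xi (qlin_poly #|F| a) g /\
    splittingFieldFor 1%VS (map_poly (in_alg M) g) fullv.
Proof.
move=> infL galM1 isoG.
have [f injf fG] := @isogP _ _ _ (Group alg_units_group_set) isoG.
have [d d0 dP] := specialize uN AN.
pose C s := GLval (f s) : 'M[F]_n.+1.
have fS s : s \in 'Gal({:M} / 1%AS)%g -> f s \in alg_units S.
  by move=> sG; rewrite -[alg_units S]fG mem_morphim.
have C_S : {in 'Gal({:M} / 1%AS)%g, forall s, C s \in S}.
  by move=> s /fS; rewrite in_set.
have C_unit : {in 'Gal({:M} / 1%AS)%g, forall s, C s \in unitmx}.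
  by move=> s _; apply: (valP (f s)).
have C_mul : {in 'Gal({:M} / 1%AS)%g &, forall s t, C (s * t)%g = C s *m C t}.
  by move=> s t sG tG; rewrite /C morphM.
have [y [xi [ty dy yE dxi]]] :=
  twisted_lang_dense freeS oneS mulS phi infL galM1 C_S C_unit C_mul d0.
have [a' [N' [aP uN' AN']]] := dP L phi _ dxi.
exists (fun i => xi 0 i), (qlin_poly #|F| a'); split=> //.
have xiE : \row_i xi 0 i = xi by apply/rowP=> i; rewrite mxE.
rewrite xiE in AN'.
apply: (over_splitting freeS oneS mulS dy yE uN' AN' galM1) => s.
have sG : s \in 'Gal({:M} / 1%AS)%g by rewrite gal_kHom ?sub1v // k1HomE; apply: ahomWin.
(* [s] acts on [X] as [C s]; if it fixes [X], cancelling [X] gives [C s = 1], and [s = 1] by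
   injectivity. *)
rewrite ty // => /(congr1 (mulmx^~ (invmx (comb v (in_alg M \o phi) y)))).
have uy := comb_unit (free_basis_mx freeS) (closed_basis_mx mulS) (one_basis_mx oneS) dy.
rewrite mulmxK // mulmxV // -(map_mx1 (in_alg M \o phi)) => /map_mx_inj Cs.
apply/eqP; rewrite -(morph_injm_eq1 injf) //; apply/eqP/val_inj.
exact: Cs.
Qed.
End Case2.

(** * The Galois group of the generic polynomial *)

Section Galois.

Variables (F : finFieldType) (n m : nat) (v : 'I_m -> 'M[F]_n.+1).
Local Notation S := <<map v (enum 'I_m)>>%VS.
Hypothesis freeS : free (map v (enum 'I_m)).
Hypothesis oneS : 1 \in S.
Hypothesis mulS : forall x y, x \in S -> y \in S -> x * y \in S.
Let freeV := free_basis_mx freeS.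
Let closedV := closed_basis_mx mulS.
Let oneV := one_basis_mx oneS.

Variables (K : fieldType) (phi : {rmorphism F -> K}) (x : 'rV[K]_m).
Hypothesis dx : lmul_det v phi x != 0.
Variable theta : {rmorphism K -> K}.
Hypothesis theta_phi : forall c, theta (phi c) = phi c.
Hypothesis theta_x : map_mx theta x = lang v phi x.
Hypothesis translations : forall C, C \in S -> C \in unitmx ->
  exists2 al : {rmorphism K -> K}, (forall c, al (theta c) = theta c) &
    comb v phi (map_mx al x) = map_mx phi C *m comb v phi x.

Variables (a' : 'I_n.+1 -> K) (N' : 'M[K]_n.+1).
Hypothesis uN' : N' \in unitmx.
Hypothesis AN' : comb v phi x *m map_mx (frob phi) N' = N' *m Delta_mx a'.
Let g := qlin_poly #|F| a'.

Lemma generic_Delta_unit : Delta_mx a' \in unitmx.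
Proof.
have uA := comb_unit freeV closedV oneV dx.
have -> : Delta_mx a' = invmx N' *m (comb v phi x *m map_mx (frob phi) N').
  by rewrite -[LHS](mulKmx uN'); congr (_ *m _); apply: esym AN'.
by rewrite !unitmx_mul unitmx_inv uN' uA map_unitmx.
Qed.

Let W := comb v phi x *m map_mx theta N'.

(** [theta] carries the generic element [X] to [X^-1 * X^(q)]. The transported equation is solved
    over [K] itself, by [X] times the image of [N'], so the image of [g] splits there. *)
Lemma generic_split : map_poly theta g =
  \prod_(w : 'rV[F]_n.+1) ('X - ((map_mx phi w *m W) 0 0)%:P).
Proof.
rewrite map_qlin; apply: qlin_split.
  by apply: solution_unit; rewrite ?map_unitmx ?dx.
apply: solution_frob; rewrite ?dx //.
rewrite -theta_x -(map_comb v x theta_phi) -(map_frob phi phi theta).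
by rewrite -map_mxM AN' map_mxM map_Delta.
Qed.

Lemma generic_power i j : W i j = W i 0 ^+ (#|F| ^ j).
Proof.
have fW : map_mx (frob phi) W = W *m Delta_mx (theta \o a').
  apply: solution_frob; rewrite ?dx //.
  rewrite -theta_x -(map_comb v x theta_phi) -(map_frob phi phi theta).
  by rewrite -map_mxM AN' map_mxM map_Delta.
have : map_mx (frob phi) (row i W) = row i W *m Delta_mx (theta \o a').
  by rewrite map_row fW row_mul.
by case/frob_row_root=> /(_ j); rewrite [row i W 0 j]mxE [row i W 0 0]mxE.
Qed.

Variables (E : splittingFieldType K) (rs : seq E).
Hypothesis g_split : map_poly (in_alg E) g %= \prod_(z <- rs) ('X - z%:P).
Hypothesis genE : <<1 & rs>>%VS = fullv.
Let phiE : {rmorphism F -> E} := in_alg E \o phi.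

(** [E] embeds into [K] over [theta]. The image contains the roots, hence the first column of [W],
    hence [W] and the coordinates [x]. The preimage [x0] serves as a solution of [lang x0 = x] in
    [E]. *)
Lemma generic_solution : exists (psi : {rmorphism E -> K}) (x0 : 'rV[E]_m),
  (forall c, psi c%:A = theta c) /\ map_mx psi x0 = x.
Proof.
pose rs' := [seq (map_mx phi w *m W) 0 0 | w <- index_enum {: 'rV[F]_n.+1}].
have [|h hE] := @embed_splitting _ _ _ theta g rs rs' _ g_split genE.
  by rewrite generic_split big_map eqpxx.
have hphi c : h (phiE c) = phi c by rewrite [LHS]hE theta_phi.
have imW i : exists y, W i 0 = h y.
  have : root (map_poly theta g) (W i 0).
    rewrite generic_split (bigD1 (delta_mx 0 i)) //= rootM root_XsubC.
    suff -> : (map_mx phi (delta_mx 0 i : 'rV_n.+1) *m W) 0 0 = W i 0 by rewrite eqxx.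
    by rewrite map_delta_mx -rowE [LHS]mxE.
  have -> : map_poly theta g = map_poly h (map_poly (in_alg E) g).
    by rewrite -map_poly_comp; apply: eq_map_poly => c; rewrite /= hE.
  have : map_poly h (map_poly (in_alg E) g) %= \prod_(z <- rs) ('X - (h z)%:P).
    have -> : \prod_(z <- rs) ('X - (h z)%:P) = map_poly h (\prod_(z <- rs) ('X - z%:P)).
      by rewrite rmorph_prod; apply: eq_bigr => z _; rewrite rmorphB /= map_polyX map_polyC.
    by rewrite eqp_map.
  move/eqp_root->; rewrite -(big_map h xpredT (fun z => 'X - z%:P)) root_prod_XsubC.
  by case/mapP=> y _ ->; exists y.
have [y yE] := fin_all_exists imW.
pose W0 : 'M[E]_n.+1 := \matrix_(i, j) y i ^+ (#|F| ^ j).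
have hW0 : map_mx h W0 = W.
  by apply/matrixP=> i j; rewrite generic_power yE !mxE rmorphXn.
exists h, (coords v phiE (W0 *m invmx (map_mx (in_alg E) N'))); split=> //.
rewrite (map_coords v _ hphi) map_mxM hW0 map_invmx -map_mx_comp.
have -> : map_mx (h \o in_alg E) N' = map_mx theta N'.
  by apply/matrixP=> i j; rewrite !mxE /= hE.
by rewrite mulmxK ?map_unitmx // combK.
Qed.

Lemma galois_group_generic : separable_poly g ->
  'Gal({:E} / 1%AS) \isog alg_units S.
Proof.
move=> sep_g; have [h [x0 [hE hx0]]] := generic_solution.
have hphi c : h (phiE c) = phi c by rewrite [LHS]hE theta_phi.
have d0 : lmul_det v phiE x0 != 0.
  by rewrite -(fmorph_eq0 h) (map_lmul_det v hphi) hx0 dx.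
have x0E : lang v phiE x0 = map_mx (in_alg E) x.
  apply: (map_mx_inj (f := h)); rewrite (map_lang v _ hphi) hx0 -theta_x.
  by apply/rowP=> i; rewrite !mxE [RHS]hE.
have u0 : comb v phiE x0 \in unitmx := comb_unit freeV closedV oneV d0.
have gal_phiE (s : gal_of {:E}) c : s (phiE c) = phiE c by apply: gal_alg.
have galE : galois 1%VS {:E}.
  apply/splitting_galoisField; exists (map_poly (in_alg E) g); split.
  - by apply/polyOverP=> i; rewrite coef_map /= rpredZ ?rpred1.
  - by rewrite separable_map.
  - by exists rs.
(* [s x0] has the same Lang image as [x0], because that image lies in [K]; the two differ by a unit
   of the algebra. *)
have solE (s : gal_of {:E}) : exists u : {'GL_n.+1[F]}, u \in alg_units S /\
    map_mx s (comb v phiE x0) = map_mx phiE (GLval u) *m comb v phiE x0.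
  have ds : lmul_det v phiE (map_mx s x0) != 0.
    by rewrite -(map_lmul_det v (gal_phiE s)) fmorph_eq0.
  have ls : lang v phiE x0 = lang v phiE (map_mx s x0).
    rewrite -(map_lang v _ (gal_phiE s)) x0E.
    by apply/rowP=> i; rewrite !mxE; apply/esym/gal_alg.
  have [u [uS uE]] := lang_fiber freeS oneS mulS d0 ds ls.
  exists u; split; first exact: uS.
  by rewrite (map_comb v x0 (gal_phiE s)).
have [f fE] := fin_all_exists solE.
(* The product in the Galois group applies [s] first; as [t] fixes the matrix of [f s], the factors
   come out in the same order. *)
have fM : {in 'Gal({:E} / 1%AS)%g &, {morph f : s t / (s * t)%g}}.
  move=> s t _ _; apply: val_inj; apply: etrans (esym (GL_ME (f s) (f t))).
  apply: (map_mx_inj (f := phiE)); apply: (can_inj (mulmxK u0)).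
  rewrite [in RHS]map_mxM -[RHS]mulmxA.
  have [_ <-] := fE t; have [_ <-] := fE (s * t)%g.
  have -> : map_mx (s * t)%g (comb v phiE x0) = map_mx t (map_mx s (comb v phiE x0)).
    by apply/matrixP=> i j; rewrite !mxE /= galM ?memvf.
  have [_ ->] := fE s; rewrite map_mxM; congr (_ *m _).
  by apply/matrixP=> i j; rewrite !mxE; apply: gal_phiE.
pose fm := Morphism fM.
have injf : ('injm fm)%g.
  apply/subsetP=> s /(morphpreP)[_ /set1P fs1]; apply/set1P.
  have sx0 : map_mx s (comb v phiE x0) = comb v phiE x0.
    have [_ ->] := fE s; have -> : f s = 1%g := fs1.
    by rewrite GL_1E map_mx1 mul1mx.
  apply: (gal_eq1 genE) => r rr.
  have := (over_gal freeS mulS d0 x0E uN' AN' s).1 sx0.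
  have : root (map_poly (in_alg E) g) r by rewrite (eqp_root g_split) root_prod_XsubC.
  rewrite (over_split freeS oneS mulS d0 x0E uN' AN').
  rewrite -(big_map _ xpredT (fun z => 'X - z%:P)) root_prod_XsubC.
  by case/mapP=> w _ -> ->.
(* Surjectivity by counting: distinct units give distinct roots in [K] of the image of [p], the
   minimal polynomial of a primitive element [z], and the degree of [p] is the order of the Galois
   group. *)
have im_f : (fm @* 'Gal({:E} / 1%AS))%g = alg_units S.
  apply/eqP; rewrite eqEcard; apply/andP; split.
    apply/subsetP=> _ /morphimP[s _ _ ->]; exact: (fE s).1.
  rewrite card_injm // -(galois_dim galE) dimv1 divn1.
  set z := separable_generator 1%AS {:E}%AS.
  have zE : (fullv : {vspace E}) = <<1; z>>%VS.
    case/and3P: galE => _ sepE _.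
    exact: (eq_adjoin_separable_generator sepE (sub1v _)).
  have [p pE] : exists p : {poly K}, minPoly 1 z = map_poly (in_alg E) p.
    have /polyOver1P[p ->] := minPolyOver 1 z.
    by exists p.
  have sz_p : size p = (\dim {:E}).+1.
    by rewrite -(size_map_poly (in_alg E)) -pE size_minPoly adjoin_degreeE dimv1 divn1 -zE.
  (* Translation by [C] fixes the image of [theta], so it sends [h z] to a root of the image of [p];
     outside the units [om] takes the default [0]. *)
  have tr C : exists om : K, C \in alg_units S ->
      exists2 al : {rmorphism K -> K}, (forall c, al (theta c) = theta c) &
        comb v phi (map_mx al x) = map_mx phi (GLval C) *m comb v phi x /\ om = al (h z).
    have [CS|_] := boolP (C \in alg_units S); last by exists 0.
    have CS' : GLval C \in S by rewrite in_set in CS.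
    have [al al_th alx] := translations CS' (valP C).
    by exists (al (h z)) => _; exists al.
  have [om omE] := fin_all_exists tr.
  rewrite -ltnS -sz_p -(size_map_poly theta) cardE -(size_map om).
  have p0 : p != 0 by rewrite -size_poly_eq0 sz_p.
  apply: max_poly_roots.
  - by rewrite map_poly_eq0.
  - apply/allP=> _ /mapP[C CS ->]; rewrite mem_enum in CS.
    have [al al_th [_ ->]] := omE C CS.
    have -> : map_poly theta p = map_poly (al \o h) (map_poly (in_alg E) p).
      by rewrite -map_poly_comp; apply: eq_map_poly => c; rewrite /= hE al_th.
    by rewrite -pE -[al _]/((al \o h) z) fmorph_root root_minPoly.
  rewrite map_inj_in_uniq ?enum_uniq // => C D; rewrite !mem_enum => CS DS.
  have [al al_th [alx ->]] := omE C CS; have [be be_th [bex ->]] := omE D DS.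
  (* Morphisms that agree on [z] agree on [E = K(z)], hence on [x], which lies in the image of [h];
     cancelling the generic element gives [C = D]. *)
  move=> eq_z; have eq_h e : al (h e) = be (h e).
    have : e \in <<1; z>>%VS by rewrite -zE memvf.
    case/Fadjoin1_polyP=> q ->; rewrite -!horner_map /= eq_z; congr (_.[_]).
    by rewrite -!map_poly_comp; apply: eq_map_poly => c; rewrite /= hE al_th be_th.
  have eq_x : map_mx al x = map_mx be x.
    by rewrite -hx0; apply/rowP=> i; rewrite !mxE.
  apply/val_inj/(map_mx_inj (f := phi)).
  have ux := comb_unit freeV closedV oneV dx.
  by apply: (can_inj (mulmxK ux)); rewrite -[LHS]alx -[RHS]bex eq_x.
rewrite -im_f; exact: sub_isog.
Qed.

End Galois.

(** * The function field *)

Section FunctionField.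

Variables (F : finFieldType) (n m : nat) (v : 'I_m -> 'M[F]_n.+1).
Local Notation S := <<map v (enum 'I_m)>>%VS.
Hypothesis freeS : free (map v (enum 'I_m)).
Hypothesis oneS : 1 \in S.
Hypothesis mulS : forall x y, x \in S -> y \in S -> x * y \in S.
Let freeV := free_basis_mx freeS.
Let closedV := closed_basis_mx mulS.
Let oneV := one_basis_mx oneS.

Variables (k : fieldType) (iota : {rmorphism F -> k}).
Hypothesis infk : infinite_field k.

Local Notation K := (ratfun k m).
Let psi : {rmorphism F -> {mpoly k[m]}} := @mpolyC m k \o iota.
Let cst : {rmorphism k -> K} := @tofrac {mpoly k[m]} \o @mpolyC m k.
Let phi : {rmorphism F -> K} := cst \o iota.
Let gen : 'rV[{mpoly k[m]}]_m := \row_i 'X_i.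
Let x : 'rV[K]_m := \row_i rf_var k i.

Lemma tofrac_psi c : tofrac (psi c) = phi c.
Proof. by []. Qed.

Lemma map_gen : map_mx (@tofrac {mpoly k[m]}) gen = x.
Proof. by apply/rowP=> i; rewrite !mxE. Qed.

Lemma eval_psi (u : 'rV[k]_m) c : meval (fun i => u 0 i) (psi c) = iota c.
Proof. by rewrite /= mevalC. Qed.

Lemma eval_gen (u : 'rV[k]_m) : map_mx (meval (fun i => u 0 i)) gen = u.
Proof. by apply/rowP=> i; rewrite !mxE mevalXU. Qed.

Lemma mmap_cst (y : 'rV[{mpoly k[m]}]_m) P :
  mmap cst (fun i => tofrac (y 0 i)) P = tofrac (mmap (@mpolyC m k) (fun i => y 0 i) P).
Proof. by apply/esym; apply: (rmorph_mmap (f := @mpolyC m k)). Qed.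

Lemma lmul_det_gen_neq0 : lmul_det v phi x != 0.
Proof.
have [|u [du _]] := lang_dominant freeV closedV oneV iota infk (p := 1).
  exact: oner_neq0.
rewrite -map_gen -(map_lmul_det v tofrac_psi) tofrac_eq0.
apply: contraNneq du => d0.
by rewrite -(eval_gen u) -(map_lmul_det v (eval_psi u)) d0 rmorph0.
Qed.

Definition lang_subst := mmap cst (fun i => lang v phi x 0 i).

(** If [P] vanishes at the Lang image of the generic point, clearing denominators gives a polynomial
    identity, whose value at a suitable [u] over [k] contradicts dominance. *)
Lemma lang_subst_inj : injective lang_subst.
Proof.
apply: raddf_inj => P; rewrite /= -/(lang_subst P) => P0.
apply/eqP; apply: contraTT isT => Pn0 /=.
have [u [du Pu]] := lang_dominant freeV closedV oneV iota infk Pn0.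
have H0 : homog_eval (@mpolyC m k) P (msize P) (lmul_det v psi gen) (lang_num v psi gen 0) = 0.
  apply/eqP; rewrite -tofrac_eq0.
  rewrite (rmorph_homog_eval (g := cst) P (msize P) (lmul_det v psi gen)
    (T' := lang_num v phi x 0)) //.
    rewrite (map_lmul_det v tofrac_psi) map_gen homog_evalE ?lmul_det_gen_neq0 //.
    have -> : mmap cst (fun i => (lmul_det v phi x)^-1 * lang_num v phi x 0 i) P =
        lang_subst P.
      by apply: eq_bigr => a _; congr (_ * _); apply: mmap1_eq => i; rewrite [RHS]mxE.
    by rewrite P0 mulr0.
  by move=> i; rewrite -map_gen -(map_lang_num v tofrac_psi) [RHS]mxE.
suff : lmul_det v iota u ^+ msize P * P.@[fun i => lang v iota u 0 i] = 0.
  by move/eqP; rewrite mulf_eq0 expf_eq0 (negPf du) andbF (negPf Pu).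
have -> : P.@[fun i => lang v iota u 0 i] =
    mmap idfun (fun i => (lmul_det v iota u)^-1 * lang_num v iota u 0 i) P.
  by apply: eq_bigr => a _; congr (_ * _); apply: mmap1_eq => i; rewrite [LHS]mxE.
rewrite -homog_evalE // -[RHS](rmorph0 (meval (fun i => u 0 i))) -H0.
have -> : lmul_det v iota u = meval (fun i => u 0 i) (lmul_det v psi gen).
  by rewrite (map_lmul_det v (eval_psi u)) eval_gen.
apply/esym; apply: rmorph_homog_eval => [c|i]; first by rewrite /= mevalC.
by rewrite -[in RHS](eval_gen u) -(map_lang_num v (eval_psi u)) [RHS]mxE.
Qed.

Definition lang_endo : {rmorphism K -> K} :=
  @frac_lift_rmorph {mpoly k[m]} K lang_subst lang_subst_inj.
Local Notation theta := lang_endo.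

Lemma lang_endo_tofrac P : theta (tofrac P) = lang_subst P.
Proof. exact: frac_lift_tofrac lang_subst_inj P. Qed.

Lemma lang_endo_cst c : theta (cst c) = cst c.
Proof. by rewrite lang_endo_tofrac /lang_subst mmapC. Qed.

Lemma lang_endo_phi c : theta (phi c) = phi c.
Proof. exact: lang_endo_cst. Qed.

Lemma lang_endo_var : map_mx theta x = lang v phi x.
Proof.
apply/rowP=> i; rewrite mxE [x _ _]mxE lang_endo_tofrac /lang_subst.
by rewrite mmapX mmap1U.
Qed.

Lemma lmul_unit (L : fieldType) (f : {rmorphism F -> L}) c :
  comb v f c \in unitmx -> lmul_mx v f c \in unitmx.
Proof.
move=> uc; rewrite -row_free_unit; apply: inj_row_free => y y0.
apply: (comb_inj freeV (phi := f)); rewrite comb0; apply: (can_inj (mulKmx uc)).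
by rewrite mulmx_comb // y0 comb0 mulmx0.
Qed.

Section Translate.

Variable C : 'M[F]_n.+1.
Hypotheses (CS : C \in S) (uC : C \in unitmx).
Let cC (R : comNzRingType) (f : {rmorphism F -> R}) := coords v f (map_mx f C).
(** Coordinates of [C] times the generic element, since [lmul_mx] acts on coordinate rows from the
    right. *)
Let gC := gen *m lmul_mx v psi (cC psi).
Definition translate_subst := mmap cst (fun i => tofrac (gC 0 i)).

Lemma map_cC (R R' : comNzRingType) (f : {rmorphism F -> R}) (f' : {rmorphism F -> R'})
    (g : {rmorphism R -> R'}) : (forall c, g (f c) = f' c) ->
  map_mx g (cC f) = cC f'.
Proof.
move=> gf; rewrite /cC (map_coords v _ gf); congr (coords _ _ _).
by apply/matrixP=> i j; rewrite !mxE gf.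
Qed.

Lemma comb_cC (R : comNzRingType) (f : {rmorphism F -> R}) :
  comb v f (cC f) = map_mx f C.
Proof. exact: mem_comb. Qed.

(** The substitution is linear and invertible, as [C] is a unit: every point [u] is the translate of
    some [u']. *)
Lemma translate_subst_inj : injective translate_subst.
Proof.
apply: raddf_inj => P; rewrite /= /translate_subst mmap_cst => /eqP.
rewrite tofrac_eq0 => /eqP P0; apply/eqP; apply: contraTT isT => Pn0 /=.
have [u0 Pu] := mpoly_nonroot infk Pn0; pose u := \row_i u0 i.
have ul : lmul_mx v iota (cC iota) \in unitmx.
  by apply: lmul_unit; rewrite comb_cC map_unitmx.
pose u' := u *m invmx (lmul_mx v iota (cC iota)).
case/eqP: Pu; rewrite -[RHS](rmorph0 (meval (fun i => u' 0 i))) -P0.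
apply/esym; apply: (rmorph_mmap (f := @mpolyC m k) (g := idfun)) => [c|i].
  by rewrite /= mevalC.
have : map_mx (meval (fun i => u' 0 i)) gC = u.
  rewrite map_mxM eval_gen (map_lmul_mx _ _ (eval_psi u')) (map_cC (eval_psi u')).
  by rewrite mulmxKV.
by move/rowP/(_ i); rewrite mxE [RHS]mxE.
Qed.

Definition translate : {rmorphism K -> K} :=
  @frac_lift_rmorph {mpoly k[m]} K translate_subst translate_subst_inj.

Lemma translate_tofrac P : translate (tofrac P) = translate_subst P.
Proof. exact: frac_lift_tofrac translate_subst_inj P. Qed.

Lemma translate_cst c : translate (cst c) = cst c.
Proof.
by rewrite translate_tofrac /translate_subst mmapC.
Qed.

Lemma translate_var : map_mx translate x = x *m lmul_mx v phi (cC phi).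
Proof.
have <- : map_mx (@tofrac {mpoly k[m]}) gC = x *m lmul_mx v phi (cC phi).
  by rewrite map_mxM map_gen (map_lmul_mx v _ tofrac_psi) (map_cC tofrac_psi).
apply/rowP=> i; rewrite [LHS]mxE [x _ _]mxE.
rewrite translate_tofrac.
by rewrite /translate_subst mmapX mmap1U [RHS]mxE.
Qed.

Lemma comb_translate : comb v phi (map_mx translate x) = map_mx phi C *m comb v phi x.
Proof. by rewrite translate_var -mulmx_comb // comb_cC. Qed.

(** The factor [C] cancels in the Lang map, because Frobenius fixes its entries. *)
Lemma translate_lang : map_mx translate (lang v phi x) = lang v phi x.
Proof.
rewrite (map_lang v (phi' := phi)) => [|c]; last exact: translate_cst.
have dC : lmul_det v phi (map_mx translate x) != 0.
  rewrite -(map_lmul_det v (phi := phi)) => [|c]; last exact: translate_cst.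
  by rewrite fmorph_eq0 lmul_det_gen_neq0.
apply/esym; apply: (langP freeV closedV oneV dC).
rewrite comb_translate -mulmxA comb_lang ?lmul_det_gen_neq0 //.
by rewrite map_mxM map_frob_id.
Qed.

(** The image of [theta] consists of fractions in constants and coordinates of the Lang image, all
    fixed by the translation. *)
Lemma translate_lang_endo c : translate (theta c) = theta c.
Proof.
have E P : translate (lang_subst P) = lang_subst P.
  apply: rmorph_mmap => [b|i]; first exact: translate_cst.
  by rewrite -[in RHS]translate_lang [RHS]mxE.
have [p [q [_ ->]]] := fracP c.
have -> : theta (tofrac p / tofrac q) = lang_subst p / lang_subst q.
  by rewrite fmorph_div; congr (_ / _); apply: lang_endo_tofrac.
by rewrite fmorph_div !E.
Qed.

End Translate.

Lemma translations C : C \in S -> C \in unitmx ->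
  exists2 al : {rmorphism K -> K}, (forall c, al (theta c) = theta c) &
    comb v phi (map_mx al x) = map_mx phi C *m comb v phi x.
Proof.
move=> CS uC; exists (translate CS uC); first exact: translate_lang_endo.
exact: comb_translate.
Qed.

(** The coefficients of [d] embed into [k], so the generic point over [k] avoids every hypersurface
    defined over [F]. *)
Lemma eval_var_neq0 d : d != 0 -> mmap phi (@rf_var k m) d != 0.
Proof.
have <- : tofrac (map_mpoly iota d) = mmap phi (@rf_var k m) d.
  by apply: (rmorph_mmap (f := psi)).
rewrite tofrac_eq0; apply: contraNneq => d0; apply/eqP/mpolyP=> b.
by apply: (fmorph_inj iota); rewrite -mcoeff_map_mpoly d0 !mcoeff0 rmorph0.
Qed.

Lemma function_field_separable (a' : 'I_n.+1 -> K) N' : N' \in unitmx ->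
  comb v phi x *m map_mx (frob phi) N' = N' *m Delta_mx a' ->
  separable_poly (qlin_poly #|F| a').
Proof.
move=> uN' AN'; apply: (separable_qlin phi).
exact: (generic_Delta_unit freeS oneS mulS lmul_det_gen_neq0 uN' AN').
Qed.

Lemma function_field_galois (a' : 'I_n.+1 -> K) N' (E : splittingFieldType K) :
  N' \in unitmx ->
  comb v phi x *m map_mx (frob phi) N' = N' *m Delta_mx a' ->
  splittingFieldFor 1%VS (map_poly (in_alg E) (qlin_poly #|F| a')) fullv ->
  'Gal({:E} / 1%AS) \isog alg_units S.
Proof.
move=> uN' AN' [rs g_split genE].
apply: (galois_group_generic freeS oneS mulS lmul_det_gen_neq0 lang_endo_phi
  lang_endo_var translations uN' AN' g_split genE).
exact: function_field_separable uN' AN'.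
Qed.

End FunctionField.

Theorem theorem4p9 (F : finFieldType) (n m : nat) (v : 'I_m -> 'M[F]_n.+1)
    (a : 'I_n.+1 -> ratfun F m) (N : 'M[ratfun F m]_n.+1) :
  let q := #|F| in
  let S : {vspace 'M[F]_n.+1} := <<map v (enum 'I_m)>>%VS in
  free (map v (enum 'I_m)) ->
  1 \in S ->
  (forall x y, x \in S -> y \in S -> x * y \in S) ->
  generic_mx v \in unitmx ->
  N \in unitmx ->
  invmx N *m generic_mx v *m map_mx (fun x => x ^+ q) N = Delta_mx a ->
  let f := qlin_poly q a in
  forall (k : fieldType) (iota : {rmorphism F -> k}), infinite_field k ->
  (* (1) over k(t), f is monic separable with Galois group A^x *)
  (exists g : {poly ratfun k m},
     [/\ poly_spec (fun c => rf_const m (iota c)) (@rf_var k m) f g,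
         g \is monic, separable_poly g &
         forall E : splittingFieldType (ratfun k m),
           splittingFieldFor 1%VS (map_poly (GRing.in_alg E) g) fullv ->
           'Gal({:E} / 1%AS) \isog alg_units S]) /\
  (* (2) every Galois A^x-extension M/L, L containing k, comes from f *)
  (forall (L : fieldType) (j : {rmorphism k -> L}) (M : splittingFieldType L),
     galois 1%VS {:M} ->
     'Gal({:M} / 1%AS) \isog alg_units S ->
     exists (xi : 'I_m -> L) (g : {poly L}),
       poly_spec (fun c => j (iota c)) xi f g /\
       splittingFieldFor 1%VS (map_poly (GRing.in_alg M) g) fullv).
Proof.
move=> q S freeS oneS mulS _ uN AN f k iota infk; split; last first.
  move=> L j M galM1 isoG.
  exact: (generic_extension freeS oneS mulS uN AN (j \o iota)
            (infinite_rmorph j infk) galM1 isoG).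
(* Specialising at the variables themselves, over [k(t)], is the base change of [f] from [F(t)]. *)
have [d d0 dP] := specialize uN AN.
have [a' [N' [aP uN' AN']]] := dP _ _ _ (eval_var_neq0 iota d0).
exists (qlin_poly q a'); split; first exact: aP.
- exact: monic_qlin.
- exact: (function_field_separable freeS oneS mulS infk uN' AN').
by move=> E; apply: (function_field_galois freeS oneS mulS infk uN' AN').
Qed.
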